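(* Let the setting and the two boundary value problems (NL) and (L) be as described in the context, and assume that there are positive real constants $C_1,\dots,C_N$ such that $$\lambda(T)=C_k\,\lambda_k(T)\qquad\text{for all } T\in\mathbb{R},\ k=1,\dots,N.$$ Then the nonlinear problem (NL) and the linear problem (L) are equivalent, in the following sense. A pair $(T,(T_k)_{k=1}^N)$ solves (NL), for given data $A,\theta$ and cell-boundary flux functions $q_j^\pm$, if and only if the functions $$u:=f(T)\ \text{in } D_{matrix},\qquad \tilde u_k:=C_k f_k(T_k)\ \text{in the copies of } D_k,$$ solve (L) with the same data $A,\theta,q_j^\pm$. Here $f(T)=\int_0^T\lambda(\xi)\,d\xi$ and $f_k(T)=\int_0^T\lambda_k(\xi)\,d\xi$. Conversely, the solution of (NL) is recovered from a solution of (L) by $$T=f^{-1}(u),\qquad T_k=f_k^{-1}\big(\tilde u_k/C_k\big).$$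
   Context: **Geometry.** Identify $\mathbb{R}^2$ with $\mathbb{C}$ via $z=x+\imath y$. Let $$Q_{(0,0)}=\{t_1+\imath t_2:\ -\tfrac12<t_1,t_2<\tfrac12\},\qquad Q_{(m_1,m_2)}=Q_{(0,0)}+m_1+\imath m_2\quad (m_1,m_2\in\mathbb{Z}).$$ Let $D_k=\{z:|z-a_k|<r_k\}$, $k=1,\dots,N$, be mutually disjoint disks whose closures lie inside $Q_{(0,0)}$, and set $D_0=Q_{(0,0)}\setminus\bigcup_{k}\overline{D_k}$. Define the matrix and the inclusions by $$D_{matrix}=\bigcup_{m_1,m_2}\big((D_0\cup\partial Q_{(0,0)})+m_1+\imath m_2\big),\qquad D_{inc}=\bigcup_{m_1,m_2}\bigcup_{k}\big(D_k+m_1+\imath m_2\big).$$ **Conductivities.** $\lambda,\lambda_1,\dots,\lambda_N\in C^\infty(\mathbb{R})$ are positive and finite-valued. **Data.** $A$ is a given flux intensity and $\theta$ a given direction angle. For each cell $Q_{(m_1,m_2)}$ there are functions $q_1^\pm(\cdot,m_1,m_2)$ and $q_2^\pm(\cdot,m_1,m_2)$ describing flux fluctuations on the top/bottom and right/left sides of the cell, in the local coordinate $-\tfrac12<x<\tfrac12$ (resp. $-\tfrac12<y<\tfrac12$). **Problem (NL).** Find $T$ in $D_{matrix}$ and $T_k$ in the copies of $D_k$ such that: - $\nabla\cdot(\lambda(T)\nabla T)=0$ in $D_{matrix}$; - $\nabla\cdot(\lambda_k(T_k)\nabla T_k)=0$ in $\bigcup_{m_1,m_2}(D_k+m_1+\imath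 m_2)$; - on the top (resp. bottom) side of each cell $Q_{(m_1,m_2)}$, $\lambda(T)T_y=-A\sin\theta+q_1^+(x+m_1,m_1,m_2)$ (resp. with $q_1^-$); - on the right (resp. left) side, $\lambda(T)T_x=-A\cos\theta+q_2^+(y+m_2,m_1,m_2)$ (resp. with $q_2^-$); - on every $\partial D_k+m_1+\imath m_2$, $T=T_k$ and $\lambda(T)\,\partial T/\partial n=\lambda_k(T_k)\,\partial T_k/\partial n$. Here $n$ is the outward unit normal to $\partial D_k$, and $T,T_k$ on the interface denote the limits from the matrix side and the inclusion side respectively. **Problem (L).** Find $u$ in $D_{matrix}$ and $\tilde u_k$ in the copies of $D_k$ such that: - $\Delta u=0$ in $D_{matrix}$; - $\Delta\tilde u_k=0$ in the copies of $D_k$; - $u_y=-A\sin\theta+q_1^\pm(x+m_1,m_1,m_2)$ on the top/bottom sides of each cell; - $u_x=-A\cos\theta+q_2^\pm(y+m_2,m_1,m_2)$ on the right/left sides of each cell; - on every $\partial D_k+m_1+\imath m_2$, $u=\tilde u_k$ and $\partial u/\partial n=\frac{1}{C_k}\,\partial\tilde u_k/\partial n$. The functions $f$ and $f_k$ are continuous and strictly increasing, hence invertible.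
   Formalization: In the recovery of (NL) from (L), the formal statement adds that u takes values in the range of f and each ũ_k/C_k in the range of f_k; since f need not map onto ℝ (e.g. λ(t)=1/(1+t²)), f⁻¹(u) is otherwise undefined. *)

(* Defs.v *)
From Stdlib Require Import Reals Lra ZArith ClassicalEpsilon.
From Coquelicot Require Import Coquelicot.
Open Scope R_scope.

Definition pdx (F : R * R -> R) (p : R * R) : R := Derive (fun t => F (t, snd p)) (fst p).
Definition pdy (F : R * R -> R) (p : R * R) : R := Derive (fun t => F (fst p, t)) (snd p).

Definition C1_at (F : R * R -> R) (p : R * R) : Prop :=
  ex_derive (fun t => F (t, snd p)) (fst p) /\
  ex_derive (fun t => F (fst p, t)) (snd p) /\
  continuous F p /\ continuous (pdx F) p /\ continuous (pdy F) p.

Definition C2_on (O : R * R -> Prop) (F : R * R -> R) : Prop :=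
  forall p, O p -> C1_at F p /\ C1_at (pdx F) p /\ C1_at (pdy F) p.

Definition dnormal (F : R * R -> R) (nv : R * R) (q : R * R) : R :=
  pdx F q * fst nv + pdy F q * snd nv.

Definition lim_within (F : R * R -> R) (D : R * R -> Prop) (p : R * R) (v : R) : Prop :=
  filterlim F (within D (locally p)) (locally v).

Definition smooth (g : R -> R) : Prop := forall (n : nat) (x : R), ex_derive_n g n x.

Definition kirchhoff (g : R -> R) (T : R) : R := RInt g 0 T.

(* inverse of an injective function g (meaningful on the range of g) *)
Definition inv_fun (g : R -> R) (y : R) : R :=
  epsilon (inhabits 0) (fun x => g x = y).

Definition shift (m1 m2 : Z) (p : R * R) : R * R := (fst p - IZR m1, snd p - IZR m2).

Definition in_Q00 (q : R * R) : Prop :=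
  -1/2 < fst q < 1/2 /\ -1/2 < snd q < 1/2.
Definition on_bdQ00 (q : R * R) : Prop :=
  -1/2 <= fst q <= 1/2 /\ -1/2 <= snd q <= 1/2 /\ ~ in_Q00 q.

Definition dist2 (p c : R * R) : R := (fst p - fst c) ^ 2 + (snd p - snd c) ^ 2.
Definition in_disk (c : R * R) (rad : R) (q : R * R) : Prop := dist2 q c < rad ^ 2.
Definition in_cdisk (c : R * R) (rad : R) (q : R * R) : Prop := dist2 q c <= rad ^ 2.

Definition in_D0 (N : nat) (a : nat -> R * R) (r : nat -> R) (q : R * R) : Prop :=
  in_Q00 q /\ forall k, (k < N)%nat -> ~ in_cdisk (a k) (r k) q.

Definition D_matrix (N : nat) (a : nat -> R * R) (r : nat -> R) (p : R * R) : Prop :=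
  exists m1 m2 : Z, in_D0 N a r (shift m1 m2 p) \/ on_bdQ00 (shift m1 m2 p).

Definition D_copy (a : nat -> R * R) (r : nat -> R) (k : nat) (m1 m2 : Z) (p : R * R) : Prop :=
  in_disk (a k) (r k) (shift m1 m2 p).

Definition D_inc_k (a : nat -> R * R) (r : nat -> R) (k : nat) (p : R * R) : Prop :=
  exists m1 m2 : Z, D_copy a r k m1 m2 p.

Definition on_interface (a : nat -> R * R) (r : nat -> R) (k : nat) (m1 m2 : Z) (p : R * R) : Prop :=
  dist2 (shift m1 m2 p) (a k) = r k ^ 2.

Definition normal (a : nat -> R * R) (r : nat -> R) (k : nat) (m1 m2 : Z) (p : R * R) : R * R :=
  ((fst (shift m1 m2 p) - fst (a k)) / r k, (snd (shift m1 m2 p) - snd (a k)) / r k).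

Definition NL (N : nat) (a : nat -> R * R) (r : nat -> R)
  (lam : R -> R) (lamk : nat -> R -> R) (A th : R)
  (q1p q1m q2p q2m : R -> Z -> Z -> R)
  (T : R * R -> R) (Tk : nat -> R * R -> R) : Prop :=
  C2_on (D_matrix N a r) T /\
  (forall p, D_matrix N a r p ->
     pdx (fun q => lam (T q) * pdx T q) p + pdy (fun q => lam (T q) * pdy T q) p = 0) /\
  (forall k, (k < N)%nat ->
     C2_on (D_inc_k a r k) (Tk k) /\
     forall p, D_inc_k a r k p ->
       pdx (fun q => lamk k (Tk k q) * pdx (Tk k) q) p
       + pdy (fun q => lamk k (Tk k q) * pdy (Tk k) q) p = 0) /\
  (forall (m1 m2 : Z) (x : R), -1/2 < x < 1/2 ->
     lam (T (IZR m1 + x, IZR m2 + 1/2)) * pdy T (IZR m1 + x, IZR m2 + 1/2)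
       = - A * sin th + q1p (x + IZR m1) m1 m2 /\
     lam (T (IZR m1 + x, IZR m2 - 1/2)) * pdy T (IZR m1 + x, IZR m2 - 1/2)
       = - A * sin th + q1m (x + IZR m1) m1 m2) /\
  (forall (m1 m2 : Z) (y : R), -1/2 < y < 1/2 ->
     lam (T (IZR m1 + 1/2, IZR m2 + y)) * pdx T (IZR m1 + 1/2, IZR m2 + y)
       = - A * cos th + q2p (y + IZR m2) m1 m2 /\
     lam (T (IZR m1 - 1/2, IZR m2 + y)) * pdx T (IZR m1 - 1/2, IZR m2 + y)
       = - A * cos th + q2m (y + IZR m2) m1 m2) /\
  (forall (k : nat) (m1 m2 : Z) (p : R * R), (k < N)%nat -> on_interface a r k m1 m2 p ->
     exists vT gT wT gTk : R,
       lim_within T (D_matrix N a r) p vT /\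
       lim_within (dnormal T (normal a r k m1 m2 p)) (D_matrix N a r) p gT /\
       lim_within (Tk k) (D_copy a r k m1 m2) p wT /\
       lim_within (dnormal (Tk k) (normal a r k m1 m2 p)) (D_copy a r k m1 m2) p gTk /\
       vT = wT /\ lam vT * gT = lamk k wT * gTk).

Definition Lpb (N : nat) (a : nat -> R * R) (r : nat -> R) (C : nat -> R) (A th : R)
  (q1p q1m q2p q2m : R -> Z -> Z -> R)
  (u : R * R -> R) (uk : nat -> R * R -> R) : Prop :=
  C2_on (D_matrix N a r) u /\
  (forall p, D_matrix N a r p -> pdx (pdx u) p + pdy (pdy u) p = 0) /\
  (forall k, (k < N)%nat ->
     C2_on (D_inc_k a r k) (uk k) /\
     forall p, D_inc_k a r k p -> pdx (pdx (uk k)) p + pdy (pdy (uk k)) p = 0) /\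
  (forall (m1 m2 : Z) (x : R), -1/2 < x < 1/2 ->
     pdy u (IZR m1 + x, IZR m2 + 1/2) = - A * sin th + q1p (x + IZR m1) m1 m2 /\
     pdy u (IZR m1 + x, IZR m2 - 1/2) = - A * sin th + q1m (x + IZR m1) m1 m2) /\
  (forall (m1 m2 : Z) (y : R), -1/2 < y < 1/2 ->
     pdx u (IZR m1 + 1/2, IZR m2 + y) = - A * cos th + q2p (y + IZR m2) m1 m2 /\
     pdx u (IZR m1 - 1/2, IZR m2 + y) = - A * cos th + q2m (y + IZR m2) m1 m2) /\
  (forall (k : nat) (m1 m2 : Z) (p : R * R), (k < N)%nat -> on_interface a r k m1 m2 p ->
     exists vu gu wu guk : R,
       lim_within u (D_matrix N a r) p vu /\
       lim_within (dnormal u (normal a r k m1 m2 p)) (D_matrix N a r) p gu /\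
       lim_within (uk k) (D_copy a r k m1 m2) p wu /\
       lim_within (dnormal (uk k) (normal a r k m1 m2 p)) (D_copy a r k m1 m2) p guk /\
       vu = wu /\ gu = / C k * guk).

(* Main.v *)
(** With [K = kirchhoff lam], proportionality gives [C k * kirchhoff (lamk k) = K],
    so both problems are related by the single substitution [u = K o T],
    [uk = K o Tk], under which [grad u = lam(T) grad T]; the equations and the flux
    conditions then translate pointwise.  The delicate point is the passage
    from (L) to (NL) at an interface point: [K] may be bounded, and the limit
    of [u] there could be an extreme value not attained by [K], in which case [T]
    would diverge.  Such a value would be a strict upper (or lower) bound of [u]
    and of all [uk], and Hopf's boundary point lemma contradicts the flux
    condition. *)

From Stdlib Require Import Reals Lra Lia ZArith Classical ClassicalEpsilon.
From Coquelicot Require Import Coquelicot.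
(* Imported last: [ZArith] also defines a constant [shift]. *)
Require Import Defs.
Open Scope R_scope.

(** * Calculus of [C1] and [C2] functions on open plane sets *)

(** The strict bound by an unattained value is global and comes from the range of [K] alone, so the
    contradiction can be found locally, at the one interface point where the limit is taken. There
    the solution is known only through limits at that point, so the boundary point lemma cannot
    presuppose continuity on the closed disk. The comparison function is therefore extended by zero
    outside the disk: it is only upper semicontinuous across the circle, but this is enough for a
    maximum on a surrounding square. The equations and side conditions are compared on open sets.
    The matrix contains the cell sides and is the complement of all lattice copies of the closed
    disks; its openness lets the identity for the gradients be differentiated once more and makes
    the fluxes on the sides ordinary interior derivatives. *)

Lemma locally_lt {U : UniformSpace} (F : U -> R) (q : U) (c : R) :
  continuous F q -> F q < c -> locally q (fun x => F x < c).
Proof.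
  intros HF Hl. apply (HF (fun y => y < c)). exact (open_lt c _ Hl).
Qed.

Lemma locally_gt {U : UniformSpace} (F : U -> R) (q : U) (c : R) :
  continuous F q -> c < F q -> locally q (fun x => c < F x).
Proof.
  intros HF Hl. apply (HF (fun y => c < y)). exact (open_gt c _ Hl).
Qed.

Lemma locally_slice_x (p : R * R) (P : R * R -> Prop) :
  locally p P -> locally (fst p) (fun t => P (t, snd p)).
Proof.
  intros [e He]. exists e. intros t Ht. apply He. split; [exact Ht | apply ball_center].
Qed.

Lemma locally_slice_y (p : R * R) (P : R * R -> Prop) :
  locally p P -> locally (snd p) (fun t => P (fst p, t)).
Proof.
  intros [e He]. exists e. intros t Ht. apply He. split; [apply ball_center | exact Ht].
Qed.

Definition C1_on (O : R * R -> Prop) (F : R * R -> R) : Prop :=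
  forall p, O p -> C1_at F p.

Lemma C2_on_C1 (O : R * R -> Prop) (F : R * R -> R) :
  C2_on O F <-> C1_on O F /\ C1_on O (pdx F) /\ C1_on O (pdy F).
Proof.
  unfold C2_on, C1_on. split.
  - intros H. split; [|split]; intros p Hp; apply (H p Hp).
  - intros (H1 & H2 & H3) p Hp. auto.
Qed.

Lemma C1_at_is_derive_x (F : R * R -> R) (p : R * R) :
  C1_at F p -> is_derive (fun t => F (t, snd p)) (fst p) (pdx F p).
Proof. intros H. apply Derive_correct, H. Qed.

Lemma C1_at_is_derive_y (F : R * R -> R) (p : R * R) :
  C1_at F p -> is_derive (fun t => F (fst p, t)) (snd p) (pdy F p).
Proof. intros H. apply Derive_correct, H. Qed.

Section OpenSet.

Context (O : R * R -> Prop) (HO : open O).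

Lemma eq_on_locally (F H : R * R -> R) (p : R * R) :
  (forall q, O q -> F q = H q) -> O p -> locally p (fun q => F q = H q).
Proof.
  intros E Hp. apply filter_imp with (2 := HO p Hp). exact E.
Qed.

Lemma pdx_ext_on (F H : R * R -> R) (p : R * R) :
  (forall q, O q -> F q = H q) -> O p -> pdx F p = pdx H p.
Proof.
  intros E Hp. apply Derive_ext_loc.
  exact (locally_slice_x _ _ (eq_on_locally _ _ _ E Hp)).
Qed.

Lemma pdy_ext_on (F H : R * R -> R) (p : R * R) :
  (forall q, O q -> F q = H q) -> O p -> pdy F p = pdy H p.
Proof.
  intros E Hp. apply Derive_ext_loc.
  exact (locally_slice_y _ _ (eq_on_locally _ _ _ E Hp)).
Qed.

Lemma continuous_ext_on (F H : R * R -> R) (p : R * R) :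
  (forall q, O q -> F q = H q) -> O p -> continuous F p -> continuous H p.
Proof.
  intros E Hp. apply continuous_ext_loc.
  exact (eq_on_locally _ _ _ E Hp).
Qed.

Lemma C1_on_ext (F H : R * R -> R) :
  (forall q, O q -> F q = H q) -> C1_on O F -> C1_on O H.
Proof.
  intros E HF p Hp. destruct (HF p Hp) as (Dx & Dy & Cf & Cx & Cy).
  split; [|split; [|split; [|split]]].
  - refine (ex_derive_ext_loc _ _ _ _ Dx).
    exact (locally_slice_x _ _ (eq_on_locally _ _ _ E Hp)).
  - refine (ex_derive_ext_loc _ _ _ _ Dy).
    exact (locally_slice_y _ _ (eq_on_locally _ _ _ E Hp)).
  - exact (continuous_ext_on _ _ _ E Hp Cf).
  - refine (continuous_ext_on _ _ _ _ Hp Cx). intros q Hq. now apply pdx_ext_on.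
  - refine (continuous_ext_on _ _ _ _ Hp Cy). intros q Hq. now apply pdy_ext_on.
Qed.

(** Continuity of [pdx F] at [p] involves [pdx F] around [p]; there it agrees with the explicit
    candidate [Fx] because [O] is open. *)
Lemma C1_on_of_partials (F Fx Fy : R * R -> R) :
  (forall p, O p ->
     is_derive (fun t => F (t, snd p)) (fst p) (Fx p) /\
     is_derive (fun t => F (fst p, t)) (snd p) (Fy p) /\
     continuous F p /\ continuous Fx p /\ continuous Fy p) ->
  C1_on O F /\ forall p, O p -> pdx F p = Fx p /\ pdy F p = Fy p.
Proof.
  intros H.
  assert (E : forall p, O p -> pdx F p = Fx p /\ pdy F p = Fy p).
  { intros p Hp. destruct (H p Hp) as (Hx & Hy & _).
    split; now apply is_derive_unique. }
  split; [|exact E].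
  intros p Hp. destruct (H p Hp) as (Hx & Hy & Cf & Cx & Cy).
  split; [|split; [|split; [|split]]].
  - eexists; exact Hx.
  - eexists; exact Hy.
  - exact Cf.
  - refine (continuous_ext_on _ _ _ _ Hp Cx). intros q Hq. symmetry. now apply E.
  - refine (continuous_ext_on _ _ _ _ Hp Cy). intros q Hq. symmetry. now apply E.
Qed.

Lemma C1_on_mult (F H : R * R -> R) :
  C1_on O F -> C1_on O H -> C1_on O (fun q => F q * H q).
Proof.
  intros HF HH.
  apply (C1_on_of_partials _ (fun q => pdx F q * H q + F q * pdx H q)
           (fun q => pdy F q * H q + F q * pdy H q)).
  intros p Hp. specialize (HF p Hp). specialize (HH p Hp).
  destruct p as [x y].
  split; [|split; [|split; [|split]]].
  - apply (is_derive_mult (fun t => F (t, y)) (fun t => H (t, y)));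
      [exact (C1_at_is_derive_x _ _ HF) | exact (C1_at_is_derive_x _ _ HH) | exact Rmult_comm].
  - apply (is_derive_mult (fun t => F (x, t)) (fun t => H (x, t)));
      [exact (C1_at_is_derive_y _ _ HF) | exact (C1_at_is_derive_y _ _ HH) | exact Rmult_comm].
  - apply (continuous_mult F H); [apply HF | apply HH].
  - apply (continuous_plus (fun q => pdx F q * H q) (fun q => F q * pdx H q));
      [apply (continuous_mult (pdx F) H) | apply (continuous_mult F (pdx H))];
      solve [apply HF | apply HH].
  - apply (continuous_plus (fun q => pdy F q * H q) (fun q => F q * pdy H q));
      [apply (continuous_mult (pdy F) H) | apply (continuous_mult F (pdy H))];
      solve [apply HF | apply HH].
Qed.

Lemma C1_on_comp (g g1 : R -> R) (F : R * R -> R) :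
  C1_on O F ->
  (forall p, O p -> is_derive g (F p) (g1 (F p)) /\ continuous g1 (F p)) ->
  C1_on O (fun q => g (F q)) /\
  forall p, O p -> pdx (fun q => g (F q)) p = g1 (F p) * pdx F p /\
                   pdy (fun q => g (F q)) p = g1 (F p) * pdy F p.
Proof.
  intros HF Hg.
  apply (C1_on_of_partials _ (fun q => g1 (F q) * pdx F q) (fun q => g1 (F q) * pdy F q)).
  intros p Hp. specialize (HF p Hp). destruct (Hg p Hp) as [Dg Cg].
  destruct p as [x y].
  assert (Cf : continuous F (x, y)) by apply HF.
  split; [|split; [|split; [|split]]].
  - rewrite Rmult_comm.
    exact (is_derive_comp g (fun t => F (t, y)) x _ _ Dg (C1_at_is_derive_x _ _ HF)).
  - rewrite Rmult_comm.
    exact (is_derive_comp g (fun t => F (x, t)) y _ _ Dg (C1_at_is_derive_y _ _ HF)).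
  - apply (continuous_comp F g); [exact Cf|].
    apply (ex_derive_continuous (V := R_NormedModule) g). eexists; exact Dg.
  - apply (continuous_mult (fun q => g1 (F q)) (pdx F)); [|apply HF].
    exact (continuous_comp F g1 _ Cf Cg).
  - apply (continuous_mult (fun q => g1 (F q)) (pdy F)); [|apply HF].
    exact (continuous_comp F g1 _ Cf Cg).
Qed.

(** The hypotheses on [g] are asked only at values of [F], since the lemma is also applied to the
    inverse Kirchhoff transform, which is controlled only on the range of the transform. *)
Lemma C2_on_comp (g g1 g2 : R -> R) (F H : R * R -> R) :
  (forall p, O p -> is_derive g (F p) (g1 (F p)) /\
     is_derive g1 (F p) (g2 (F p)) /\ continuous g2 (F p)) ->
  (forall p, O p -> H p = g (F p)) ->
  C2_on O F ->
  C2_on O H /\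
  forall p, O p -> pdx H p = g1 (F p) * pdx F p /\ pdy H p = g1 (F p) * pdy F p.
Proof.
  intros Hg E HF. apply C2_on_C1 in HF. destruct HF as (HF & HFx & HFy).
  assert (E' : forall q, O q -> g (F q) = H q) by (intros; symmetry; auto).
  destruct (C1_on_comp g g1 F HF) as [HG DG].
  { intros p Hp. destruct (Hg p Hp) as (D1 & D2 & _). split; [exact D1|].
    apply (ex_derive_continuous (V := R_NormedModule) g1). eexists; exact D2. }
  destruct (C1_on_comp g1 g2 F HF) as [HG1 _].
  { intros p Hp. now destruct (Hg p Hp). }
  assert (DH : forall p, O p ->
    pdx H p = g1 (F p) * pdx F p /\ pdy H p = g1 (F p) * pdy F p).
  { intros p Hp. rewrite <- (pdx_ext_on _ _ _ E' Hp), <- (pdy_ext_on _ _ _ E' Hp).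
    now apply DG. }
  split; [|exact DH].
  apply C2_on_C1. split; [|split].
  - exact (C1_on_ext _ _ E' HG).
  - refine (C1_on_ext _ _ _ (C1_on_mult _ _ HG1 HFx)).
    intros q Hq. symmetry. now apply DH.
  - refine (C1_on_ext _ _ _ (C1_on_mult _ _ HG1 HFy)).
    intros q Hq. symmetry. now apply DH.
Qed.

End OpenSet.

Lemma pdx_opp (F : R * R -> R) (p : R * R) : pdx (fun q => - F q) p = - pdx F p.
Proof. exact (Derive_opp (fun t => F (t, snd p)) (fst p)). Qed.

Lemma pdy_opp (F : R * R -> R) (p : R * R) : pdy (fun q => - F q) p = - pdy F p.
Proof. exact (Derive_opp (fun t => F (fst p, t)) (snd p)). Qed.

Lemma dnormal_opp (F : R * R -> R) (n q : R * R) :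
  dnormal (fun p => - F p) n q = - dnormal F n q.
Proof. unfold dnormal. rewrite pdx_opp, pdy_opp. ring. Qed.

Lemma dnormal_opp_r (F : R * R -> R) (n q : R * R) :
  dnormal F (- fst n, - snd n) q = - dnormal F n q.
Proof. unfold dnormal; simpl. ring. Qed.

Lemma lim_within_ext (F H : R * R -> R) (D : R * R -> Prop) (p : R * R) (v : R) :
  (forall q, D q -> F q = H q) -> lim_within F D p v -> lim_within H D p v.
Proof. apply filterlim_within_ext. Qed.

Lemma lim_within_comp (g : R -> R) (F : R * R -> R) (D : R * R -> Prop) (p : R * R) (v : R) :
  continuous g v -> lim_within F D p v -> lim_within (fun q => g (F q)) D p (g v).
Proof. intros Hg HF. exact (filterlim_comp _ _ _ _ _ _ _ _ HF Hg). Qed.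

Lemma lim_within_mult (F H : R * R -> R) (D : R * R -> Prop) (p : R * R) (v w : R) :
  lim_within F D p v -> lim_within H D p w ->
  lim_within (fun q => F q * H q) D p (v * w).
Proof.
  intros HF HH.
  exact (filterlim_comp_2 _ _ _ HF HH (filterlim_mult (K := R_AbsRing) v w)).
Qed.

Lemma lim_within_opp (F : R * R -> R) (D : R * R -> Prop) (p : R * R) (v : R) :
  lim_within F D p v -> lim_within (fun q => - F q) D p (- v).
Proof.
  apply (lim_within_comp Ropp).
  apply (continuous_opp (V := R_NormedModule) (fun x => x)), continuous_id.
Qed.

(** Continuous partials near the point make [F] differentiable there, and the chain rule applies.
    With an arbitrary vector [d], [dnormal F d] is the directional derivative. *)
Lemma is_derive_along (F : R * R -> R) (p d : R * R) (t : R) :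
  (locally (fst p + t * fst d, snd p + t * snd d) (fun q => C1_at F q)) ->
  is_derive (fun s => F (fst p + s * fst d, snd p + s * snd d)) t
    (dnormal F d (fst p + t * fst d, snd p + t * snd d)).
Proof.
  intros HF. set (q := (fst p + t * fst d, snd p + t * snd d)) in *.
  assert (H : filterdiff (fun u : R * R => F (fst u, snd u)) (locally q)
     (fun u : R * R => plus (scal (fst u) (pdx F q)) (scal (snd u) (pdy F q)))).
  { apply (is_derive_filterdiff (fun x y => F (x, y)) (fst q) (snd q)
             (fun x y => pdx F (x, y)) (pdy F q)).
    - apply filter_imp with (2 := HF). intros u Hu. destruct u as [x y].
      exact (C1_at_is_derive_x _ _ Hu).
    - exact (C1_at_is_derive_y _ _ (locally_singleton _ _ HF)).
    - apply (continuous_ext (pdx F)); [now intros []|].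
      apply (locally_singleton _ _ HF). }
  unfold is_derive.
  refine (filterdiff_ext_lin _ _ _
    (filterdiff_comp'_2 (fun s => fst p + s * fst d) (fun s => snd p + s * snd d)
       (fun x y => F (x, y)) t (fun y => scal y (fst d)) (fun y => scal y (snd d))
       (fun x y => plus (scal x (pdx F q)) (scal y (pdy F q))) _ _ H) _).
  - assert (D : is_derive (fun s => fst p + s * fst d) t (fst d))
      by (auto_derive; [exact I | ring]). exact D.
  - assert (D : is_derive (fun s => snd p + s * snd d) t (snd d))
      by (auto_derive; [exact I | ring]). exact D.
  - intros y. unfold dnormal, plus, scal; simpl. unfold mult; simpl. ring.
Qed.

(** * Hopf's boundary point lemma on a disk *)

Definition in_rect (a b a' b' : R) (q : R * R) : Prop :=
  a <= fst q <= b /\ a' <= snd q <= b'.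

(** Compactness in the form used below: [P q d] weakens as [d] shrinks, and margins that are valid
    near each point have a common positive lower bound. *)
Lemma compact_margin (a b a' b' : R) (P : R * R -> R -> Prop) :
  (forall q d d', P q d -> 0 < d' <= d -> P q d') ->
  (forall q, in_rect a b a' b' q -> exists d, 0 < d /\ locally q (fun q' => P q' d)) ->
  exists d, 0 < d /\ forall q, in_rect a b a' b' q -> P q d.
Proof.
  intros Pm Hloc.
  (* One number [e] is both the radius of the neighbourhood and the margin, because compactness
     bounds a single gauge from below. Outside the rectangle the value 1 is a placeholder that makes
     the gauge total. *)
  assert (Hd : forall u v, exists e : posreal, in_rect a b a' b' (u, v) ->
    forall x y, Rabs (x - u) < e -> Rabs (y - v) < e -> P (x, y) e).
  { intros u v. destruct (classic (in_rect a b a' b' (u, v))) as [H|H];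
      [|exists (mkposreal 1 Rlt_0_1); tauto].
    destruct (Hloc _ H) as (d & Hd & [e He]).
    assert (Hm : 0 < Rmin d e) by (apply Rmin_pos; [exact Hd | apply cond_pos]).
    exists (mkposreal _ Hm). intros _ x y Hx Hy; simpl in *.
    apply Pm with d; [|split; [exact Hm | apply Rmin_l]].
    apply He. assert (Rmin d e <= e) by apply Rmin_r.
    split.
    - change (Rabs (x - u) < e). lra.
    - change (Rabs (y - v) < e). lra. }
  destruct (compactness_value_2d a b a' b'
    (fun u v => proj1_sig (constructive_indefinite_description _ (Hd u v)))) as [d H].
  exists d. split; [apply cond_pos|]. intros [x y] [Hx Hy]; simpl in Hx, Hy.
  destruct (NNPP _ (H x y Hx Hy)) as (u & v & Hu & Hv & Hxu & Hyv & Hle).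
  destruct (constructive_indefinite_description _ (Hd u v)) as [e He]; simpl in *.
  apply Pm with e; [|split; [apply cond_pos | exact Hle]].
  apply He; [split|..]; assumption.
Qed.

(** Compactness is used twice. Local upper bounds, coded as [/ d] so that they weaken as [d]
    shrinks, give a finite supremum [M]; if [M] were not attained, the local gaps below [M] would
    have a common size, and [M] would not be the least bound. *)
Lemma usc_attains_max (a b a' b' : R) (f : R * R -> R) :
  a <= b -> a' <= b' ->
  (forall q, in_rect a b a' b' q -> forall e, 0 < e -> locally q (fun q' => f q' < f q + e)) ->
  exists q, in_rect a b a' b' q /\ forall q', in_rect a b a' b' q' -> f q' <= f q.
Proof.
  intros Hab Hab' Husc.
  destruct (compact_margin a b a' b' (fun q d => f q <= / d)) as (d0 & Hd0 & Hbd).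
  { intros q d d' H Hd. apply Rle_trans with (1 := H). apply Rinv_le_contravar; lra. }
  { intros q Hq. assert (Hp : 0 < Rabs (f q) + 1) by (pose proof (Rabs_pos (f q)); lra).
    exists (/ (Rabs (f q) + 1)). split; [now apply Rinv_0_lt_compat|].
    apply filter_imp with (2 := Husc q Hq 1 Rlt_0_1). intros q' Hq'.
    rewrite Rinv_inv. pose proof (Rle_abs (f q)). lra. }
  destruct (completeness (fun y => exists q, in_rect a b a' b' q /\ y = f q)) as [M [HM HM']].
  { exists (/ d0). intros y (q & Hq & ->). now apply Hbd. }
  { exists (f (a, a')). exists (a, a'). split; [|reflexivity]. split; simpl; lra. }
  apply NNPP. intros Hno.
  destruct (compact_margin a b a' b' (fun q d => f q <= M - d)) as (d & Hd & Hlt).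
  { intros; lra. }
  { intros q Hq. assert (f q < M).
    { destruct (Rle_lt_or_eq_dec (f q) M) as [H|H]; [|exact H|].
      - apply HM. now exists q.
      - exfalso. apply Hno. exists q. split; [exact Hq|]. intros q' Hq'. rewrite H.
        apply HM. now exists q'. }
    exists ((M - f q) / 2). split; [lra|].
    assert (He : 0 < (M - f q) / 2) by lra.
    apply filter_imp with (2 := Husc q Hq _ He). intros q' Hq'. lra. }
  assert (M <= M - d); [|lra].
  apply HM'. intros y (q & Hq & ->). now apply Hlt.
Qed.

Lemma is_derive_minus_const (f : R -> R) (c x l : R) :
  is_derive f x l -> is_derive (fun t => f t - c) x l.
Proof.
  intros H. rewrite <- (Rminus_0_r l).
  exact (is_derive_minus f (fun _ => c) x l 0 H (is_derive_const c x)).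
Qed.

(** If [l] were positive, [f1], which vanishes at the maximum [x], would be positive just to the
    right of it, and the mean value theorem would push [f] above [f x]. *)
Lemma local_max_second_derive (f f1 : R -> R) (x l : R) :
  locally x (fun t => is_derive f t (f1 t)) -> is_derive f1 x l ->
  locally x (fun t => f t <= f x) -> l <= 0.
Proof.
  intros Hf Hf1 Hmax. apply Rnot_lt_le. intros Hl.
  destruct (filter_and _ _ Hf Hmax) as [e He].
  assert (Hx : is_derive f x (f1 x)) by (apply He, ball_center).
  assert (E0 : f1 x = 0).
  { assert (pr : derivable_pt f x) by (exists (f1 x); now apply is_derive_Reals).
    rewrite <- (is_derive_unique _ _ _ Hx), <- (Derive_Reals f x pr).
    apply (deriv_maximum f (x - e) (x + e)).
    - pose proof (cond_pos e). lra.
    - pose proof (cond_pos e). lra.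
    - intros t Ht1 Ht2. apply He. change (Rabs (t - x) < e). apply Rabs_def1; lra. }
  apply is_derive_Reals in Hf1.
  destruct (Hf1 (l / 2)) as [d Hd]; [lra|].
  pose proof (cond_pos e). pose proof (cond_pos d).
  set (h := Rmin e d / 2).
  assert (Hh : 0 < h /\ h < e /\ h < d).
  { assert (0 < Rmin e d) by (apply Rmin_pos; apply cond_pos).
    pose proof (Rmin_l e d). pose proof (Rmin_r e d). unfold h. lra. }
  destruct (MVT_cor2 f f1 x (x + h)) as (c & Hc & Hc'); [lra| |].
  { intros t Ht. apply is_derive_Reals. apply He. change (Rabs (t - x) < e). apply Rabs_def1; lra. }
  assert (Hxh : f (x + h) <= f x).
  { apply He. change (Rabs (x + h - x) < e). apply Rabs_def1; lra. }
  specialize (Hd (c - x)). replace (x + (c - x)) with c in Hd by ring.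
  rewrite E0, Rminus_0_r in Hd.
  assert (Hd' : Rabs (f1 c / (c - x) - l) < l / 2).
  { apply Hd; [lra|]. apply Rabs_def1; lra. }
  apply Rabs_def2 in Hd'.
  assert (0 < f1 c).
  { replace (f1 c) with (f1 c / (c - x) * (c - x)) by (field; lra).
    apply Rmult_lt_0_compat; lra. }
  assert (0 < f1 c * (x + h - x)) by (apply Rmult_lt_0_compat; lra).
  lra.
Qed.

Lemma continuous_dist2 (b q : R * R) : continuous (fun q' => dist2 q' b) q.
Proof.
  unfold dist2. simpl.
  assert (Cx : continuous (fun q' : R * R => fst q' - fst b) q).
  { apply (continuous_minus (V := R_NormedModule)); [apply continuous_fst | apply continuous_const]. }
  assert (Cy : continuous (fun q' : R * R => snd q' - snd b) q).
  { apply (continuous_minus (V := R_NormedModule)); [apply continuous_snd | apply continuous_const]. }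
  apply (continuous_plus (V := R_NormedModule)).
  - apply (continuous_mult (K := R_AbsRing)); [exact Cx|].
    apply (continuous_mult (K := R_AbsRing)); [exact Cx | apply continuous_const].
  - apply (continuous_mult (K := R_AbsRing)); [exact Cy|].
    apply (continuous_mult (K := R_AbsRing)); [exact Cy | apply continuous_const].
Qed.

Lemma open_in_disk (b : R * R) (r : R) : open (in_disk b r).
Proof.
  intros q Hq. exact (locally_lt _ _ _ (continuous_dist2 b q) Hq).
Qed.

(* On [3 r^2 / 4 < s], the function [(r^2 - s) + (2 / r^2) (r^2 - s)^2] of
   [s = |q - b|^2] is strictly subharmonic, since the Laplacian of [phi(s)] is
   [4 phi'(s) + 4 s phi''(s)]. *)
Definition barrier (b : R * R) (r : R) (q : R * R) : R :=
  (r ^ 2 - dist2 q b) + 2 / r ^ 2 * (r ^ 2 - dist2 q b) ^ 2.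

Lemma continuous_barrier (b q : R * R) (r : R) : continuous (barrier b r) q.
Proof.
  unfold barrier.
  apply (continuous_comp (fun q => dist2 q b)
           (fun s => (r ^ 2 - s) + 2 / r ^ 2 * (r ^ 2 - s) ^ 2)).
  - apply continuous_dist2.
  - apply (ex_derive_continuous (V := R_NormedModule)). auto_derive. exact I.
Qed.

(** Quantitative core of Hopf's lemma: a small multiple of the barrier still fits between [w] and
    [c]. The comparison function [w - c + e * h] cannot have a positive maximum, neither in the
    inner disk, where [w] stays uniformly below [c], nor in the outer annulus, where it is strictly
    subharmonic. *)
Lemma hopf_barrier (w : R * R -> R) (b : R * R) (r c : R) :
  0 < r -> C2_on (in_disk b r) w ->
  (forall q, in_disk b r q -> pdx (pdx w) q + pdy (pdy w) q = 0) ->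
  (forall q, in_disk b r q -> w q < c) ->
  exists kappa, 0 < kappa /\
    forall q, in_disk b r q -> w q <= c - kappa * (r ^ 2 - dist2 q b).
Proof.
  intros Hr HC2 Hlap Hlt.
  assert (Hr2 : 0 < r ^ 2) by (apply pow_lt; exact Hr).
  set (rect := in_rect (fst b - r) (fst b + r) (snd b - r) (snd b + r)).
  assert (Hrect : forall q, in_disk b r q -> rect q).
  { intros q Hq. unfold in_disk, dist2 in Hq.
    pose proof (pow2_ge_0 (fst q - fst b)). pose proof (pow2_ge_0 (snd q - snd b)).
    assert (H1 : Rabs (fst q - fst b) < Rabs r) by (apply Rsqr_lt_abs_0; rewrite !Rsqr_pow2; lra).
    assert (H2 : Rabs (snd q - snd b) < Rabs r) by (apply Rsqr_lt_abs_0; rewrite !Rsqr_pow2; lra).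
    rewrite (Rabs_pos_eq r) in H1, H2 by lra.
    apply Rabs_def2 in H1. apply Rabs_def2 in H2. repeat split; lra. }
  assert (Cw : forall q, in_disk b r q -> continuous w q) by (intros q Hq; apply (HC2 q Hq)).
  (* On the inner closed disk, where the barrier is not claimed to be subharmonic, a uniform gap [d]
     below [c] is available. *)
  destruct (compact_margin (fst b - r) (fst b + r) (snd b - r) (snd b + r)
    (fun q d => dist2 q b <= 3 / 4 * r ^ 2 -> w q <= c - d)) as (d & Hd & Hin).
  { intros q d d' H Hd Hq. specialize (H Hq). lra. }
  { intros q _. destruct (Rle_lt_dec (dist2 q b) (3 / 4 * r ^ 2)) as [H|H].
    - assert (Hq : in_disk b r q) by (unfold in_disk; lra).
      specialize (Hlt q Hq). exists ((c - w q) / 2). split; [lra|].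
      apply filter_imp with (2 := locally_lt w q ((c + w q) / 2) (Cw q Hq) ltac:(lra)).
      intros; lra.
    - exists 1. split; [lra|].
      apply filter_imp with (2 := locally_gt _ q _ (continuous_dist2 b q) H).
      intros; lra. }
  (* The barrier is at most [r ^ 2 + (2 / r ^ 2) * r ^ 4 = 3 * r ^ 2] in the disk, so [e] times it
     never exceeds the gap [d]. *)
  set (e := d / (3 * r ^ 2)).
  assert (He : 0 < e) by (apply Rdiv_lt_0_compat; lra).
  assert (Hed : e * (3 * r ^ 2) = d) by (unfold e; field; lra).
  exists e. split; [exact He|].
  set (h := barrier b r).
  (* Inside the disk [f < e * h] because [w < c], and [h] vanishes on the circle; hence the
     extension by zero is upper semicontinuous there whatever [w] does near the circle. *)
  set (f := fun q => if Rlt_dec (dist2 q b) (r ^ 2) then w q - c + e * h q else 0).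
  assert (fin : forall q, in_disk b r q -> f q = w q - c + e * h q).
  { intros q Hq. unfold f. destruct (Rlt_dec (dist2 q b) (r ^ 2)) as [_|n]; [reflexivity|].
    exfalso; exact (n Hq). }
  assert (fout : forall q, ~ in_disk b r q -> f q = 0).
  { intros q Hq. unfold f. destruct (Rlt_dec (dist2 q b) (r ^ 2)) as [y|_]; [|reflexivity].
    exfalso; exact (Hq y). }
  assert (Ceh : forall q, continuous (fun q => e * h q) q).
  { intros q. apply (continuous_mult (K := R_AbsRing)); [apply continuous_const|].
    apply continuous_barrier. }
  destruct (usc_attains_max (fst b - r) (fst b + r) (snd b - r) (snd b + r) f)
    as (q & Hq & Hmax); [lra | lra | |].
  { intros q _ eta Heta.
    destruct (Rtotal_order (dist2 q b) (r ^ 2)) as [H|[H|H]].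
    - assert (Cf : continuous f q).
      { apply (continuous_ext_on _ (open_in_disk b r) (fun q => w q - c + e * h q));
          [intros; symmetry; auto | exact H |].
        apply (continuous_plus (V := R_NormedModule)); [|apply Ceh].
        apply (continuous_minus (V := R_NormedModule)); [now apply Cw | apply continuous_const]. }
      apply locally_lt; [exact Cf | lra].
    - assert (h q = 0) by (unfold h, barrier; rewrite H; ring).
      rewrite (fout q) by (unfold in_disk; lra).
      apply filter_imp with (2 := locally_lt (fun q => e * h q) q eta (Ceh q) ltac:(cbv beta; nra)).
      intros q' Hq'. destruct (classic (in_disk b r q')) as [Hi|Hi].
      + rewrite (fin q' Hi). specialize (Hlt q' Hi). lra.
      + rewrite (fout q' Hi). lra.
    - rewrite (fout q) by (unfold in_disk; lra).
      apply filter_imp with (2 := locally_gt _ q _ (continuous_dist2 b q) H).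
      intros q' Hq'. rewrite (fout q'); [lra|]. unfold in_disk; lra. }
  assert (Hle : f q <= 0).
  { apply Rnot_lt_le. intros Hpos.
    assert (Hi : in_disk b r q).
    { apply NNPP. intros Hi. rewrite (fout q Hi) in Hpos. lra. }
    assert (Hs : 3 / 4 * r ^ 2 < dist2 q b).
    { apply Rnot_le_lt. intros Hs. specialize (Hin q Hq Hs). rewrite (fin q Hi) in Hpos.
      assert (h q <= 3 * r ^ 2).
      { unfold h, barrier.
        assert (0 <= dist2 q b) by (unfold dist2; apply Rplus_le_le_0_compat; apply pow2_ge_0).
        assert (2 / r ^ 2 * (r ^ 2 - dist2 q b) ^ 2 <= 2 / r ^ 2 * (r ^ 2) ^ 2).
        { apply Rmult_le_compat_l.
          - apply Rlt_le, Rdiv_lt_0_compat; lra.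
          - apply pow_incr. lra. }
        replace (2 / r ^ 2 * (r ^ 2) ^ 2) with (2 * r ^ 2) in H0 by (field; lra). lra. }
      assert (e * h q <= e * (3 * r ^ 2)) by (apply Rmult_le_compat_l; lra).
      lra. }
    assert (Hloc : locally q (fun q' => in_disk b r q' /\ f q' <= f q)).
    { apply filter_imp with (2 := open_in_disk b r q Hi). intros q' Hq'.
      split; [exact Hq'|]. apply Hmax, Hrect, Hq'. }
    set (k := 2 / r ^ 2) in *.
    assert (Lx : pdx (pdx w) q + e * (-2 - 4 * k * (r ^ 2 - dist2 q b)
                   + 8 * k * (fst q - fst b) ^ 2) <= 0).
    { apply (local_max_second_derive (fun t => f (t, snd q))
        (fun t => pdx w (t, snd q) + e * (-2 * (t - fst b)
            - 4 * k * (r ^ 2 - dist2 (t, snd q) b) * (t - fst b))) (fst q)).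
      - apply filter_imp with (2 := locally_slice_x q _ (locally_open _ _ (open_in_disk b r) (fun _ H => H) q Hi)).
        intros t Ht.
        apply (is_derive_ext_loc (fun t => w (t, snd q) - c + e * h (t, snd q))).
        + apply filter_imp with (2 := locally_slice_x _ _ (open_in_disk b r _ Ht)).
          intros s Hs'. symmetry. exact (fin _ Hs').
        + apply (is_derive_plus (K := R_AbsRing) (V := R_NormedModule)
                  (fun t => w (t, snd q) - c)).
          * exact (is_derive_minus_const _ c _ _ (C1_at_is_derive_x _ _ (proj1 (HC2 _ Ht)))).
          * unfold h, barrier, dist2; simpl. auto_derive; [exact I|].
            unfold k; field; lra.
      - apply (is_derive_plus (K := R_AbsRing) (V := R_NormedModule) (fun t => pdx w (t, snd q))).
        + exact (C1_at_is_derive_x _ _ (proj1 (proj2 (HC2 _ Hi)))).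
        + unfold dist2; simpl. auto_derive; [exact I|]. ring.
      - destruct q as [q1 q2]. apply (locally_slice_x (q1, q2) (fun q' => f q' <= f (q1, q2))).
        apply filter_imp with (2 := Hloc). tauto. }
    assert (Ly : pdy (pdy w) q + e * (-2 - 4 * k * (r ^ 2 - dist2 q b)
                   + 8 * k * (snd q - snd b) ^ 2) <= 0).
    { apply (local_max_second_derive (fun t => f (fst q, t))
        (fun t => pdy w (fst q, t) + e * (-2 * (t - snd b)
            - 4 * k * (r ^ 2 - dist2 (fst q, t) b) * (t - snd b))) (snd q)).
      - apply filter_imp with (2 := locally_slice_y q _ (locally_open _ _ (open_in_disk b r) (fun _ H => H) q Hi)).
        intros t Ht.
        apply (is_derive_ext_loc (fun t => w (fst q, t) - c + e * h (fst q, t))).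
        + apply filter_imp with (2 := locally_slice_y _ _ (open_in_disk b r _ Ht)).
          intros s Hs'. symmetry. exact (fin _ Hs').
        + apply (is_derive_plus (K := R_AbsRing) (V := R_NormedModule)
                  (fun t => w (fst q, t) - c)).
          * exact (is_derive_minus_const _ c _ _ (C1_at_is_derive_y _ _ (proj1 (HC2 _ Ht)))).
          * unfold h, barrier, dist2; simpl. auto_derive; [exact I|].
            unfold k; field; lra.
      - apply (is_derive_plus (K := R_AbsRing) (V := R_NormedModule) (fun t => pdy w (fst q, t))).
        + exact (C1_at_is_derive_y _ _ (proj2 (proj2 (HC2 _ Hi)))).
        + unfold dist2; simpl. auto_derive; [exact I|]. ring.
      - destruct q as [q1 q2]. apply (locally_slice_y (q1, q2) (fun q' => f q' <= f (q1, q2))).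
        apply filter_imp with (2 := Hloc). tauto. }
    specialize (Hlap q Hi).
    assert (Hk : k * r ^ 2 = 2) by (unfold k; field; lra).
    assert (Hk0 : 0 < k) by (unfold k; apply Rdiv_lt_0_compat; lra).
    assert (Hks : 3 / 2 < k * dist2 q b).
    { replace (3 / 2) with (k * (3 / 4 * r ^ 2)) by (rewrite <- (Rmult_comm (r ^ 2)); nra).
      now apply Rmult_lt_compat_l. }
    (* Adding [Lx] and [Ly] removes the Laplacian of [w] and leaves [e] times that of the barrier.
       As [k * r ^ 2 = 2] and [k * dist2 q b > 3 / 2], the bracket is larger than
       [-4 - 16 + 24 = 4]. *)
    assert (Hsum : e * (-4 - 8 * (k * r ^ 2) + 16 * (k * dist2 q b)) <= 0).
    { unfold dist2 in *. nra. }
    rewrite Hk in Hsum. nra. }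
  intros q' Hq'.
  specialize (Hmax q' (Hrect q' Hq')). rewrite (fin q' Hq') in Hmax.
  assert (r ^ 2 - dist2 q' b <= h q').
  { unfold h, barrier.
    assert (0 <= 2 / r ^ 2 * (r ^ 2 - dist2 q' b) ^ 2); [|lra].
    apply Rmult_le_pos; [apply Rlt_le, Rdiv_lt_0_compat; lra | apply pow2_ge_0]. }
  assert (e * (r ^ 2 - dist2 q' b) <= e * h q') by (apply Rmult_le_compat_l; lra).
  lra.
Qed.

Definition ray (p d : R * R) (t : R) : R * R := (fst p + t * fst d, snd p + t * snd d).

Lemma locally_ray (p d : R * R) (P : R * R -> Prop) :
  locally p P -> exists t0, 0 < t0 /\ forall t, 0 < t < t0 -> P (ray p d t).
Proof.
  intros HP.
  assert (C : continuous (ray p d) 0).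
  { assert (D : continuous (fun t => fst p + t * fst d) 0)
      by (apply (ex_derive_continuous (V := R_NormedModule)); auto_derive; exact I).
    assert (D' : continuous (fun t => snd p + t * snd d) 0)
      by (apply (ex_derive_continuous (V := R_NormedModule)); auto_derive; exact I).
    apply (continuous_comp_2 _ _ (fun x y => (x, y)) _ D D').
    apply (continuous_ext (fun x => x)); [now intros [] | apply continuous_id]. }
  destruct (C P) as [e He].
  { unfold ray. rewrite !Rmult_0_l, !Rplus_0_r. now destruct p. }
  exists e. split; [apply cond_pos|]. intros t Ht. apply He.
  change (Rabs (t - 0) < e). apply Rabs_def1; lra.
Qed.

Lemma lim_along_ray (O : R * R -> Prop) (F : R * R -> R) (p d : R * R) (t1 v : R) :
  0 < t1 -> (forall t, 0 < t < t1 -> O (ray p d t)) -> lim_within F O p v ->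
  forall e, 0 < e ->
  exists t0, 0 < t0 /\ forall t, 0 < t < t0 -> Rabs (F (ray p d t) - v) < e.
Proof.
  intros Ht1 HO HF e He.
  destruct (locally_ray p d (fun q => O q -> Rabs (F q - v) < e)) as (t0 & Ht0 & H).
  { apply (HF (fun y => Rabs (y - v) < e)). now exists (mkposreal e He). }
  exists (Rmin t0 t1). split; [now apply Rmin_pos|].
  intros t Ht. pose proof (Rmin_l t0 t1). pose proof (Rmin_r t0 t1).
  apply H; [lra | apply HO; lra].
Qed.

(** Only the limit of [F] at [p] is available, so the mean value theorem is applied between two
    points [s < t] of the ray, with [s] close to 0. A limiting slope above [- kappa] would carry [F]
    above the line [c - kappa * t]. *)
Lemma slope_along_ray (O : R * R -> Prop) (F : R * R -> R) (p d : R * R) (c kappa l t1 : R) :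
  open O -> C1_on O F -> 0 < t1 ->
  (forall t, 0 < t < t1 -> O (ray p d t) /\ F (ray p d t) <= c - kappa * t) ->
  lim_within F O p c -> lim_within (dnormal F d) O p l ->
  l <= - kappa.
Proof.
  intros HO HF Ht1 Hray Hc Hl. apply Rnot_lt_le. intros Hlk.
  assert (HrO : forall t, 0 < t < t1 -> O (ray p d t)) by (intros; now apply Hray).
  (* The midpoint of [l] and [- kappa]: near [p] the derivative stays above [m], and [m] still
     exceeds [- kappa]. *)
  set (m := (l - kappa) / 2).
  destruct (lim_along_ray O _ p d t1 l Ht1 HrO Hl (l - m)) as (t2 & Ht2 & Hm);
    [unfold m; lra|].
  set (t := Rmin t1 t2 / 2).
  assert (Ht : 0 < t /\ t < t1 /\ t < t2).
  { assert (0 < Rmin t1 t2) by now apply Rmin_pos.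
    pose proof (Rmin_l t1 t2). pose proof (Rmin_r t1 t2). unfold t. lra. }
  (* Half of the gap at [t] between the lines of slopes [m] and [- kappa]. One half absorbs the
     error of [F] at [s], the other the missing increment [m * s]. *)
  set (e := (kappa + m) * t / 2).
  assert (He : 0 < e).
  { assert (0 < (kappa + m) * t); [|unfold e; lra].
    apply Rmult_lt_0_compat; [unfold m; lra | lra]. }
  destruct (lim_along_ray O _ p d t1 c Ht1 HrO Hc e He) as (t3 & Ht3 & Hs).
  pose proof (Rabs_pos m) as Hm0.
  (* The sign of [m] is unknown, so [m * s < e] is secured through [Rabs m + 1], which is also a
     nonzero divisor. *)
  set (s0 := Rmin t (Rmin t3 (e / (Rabs m + 1)))).
  assert (Hq : 0 < e / (Rabs m + 1)) by (apply Rdiv_lt_0_compat; lra).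
  assert (Hs0 : 0 < s0) by (repeat apply Rmin_pos; lra).
  assert (Hs1 : s0 <= t) by apply Rmin_l.
  assert (Hs2 : s0 <= t3) by (eapply Rle_trans; [apply Rmin_r | apply Rmin_l]).
  assert (Hs3 : s0 <= e / (Rabs m + 1)) by (eapply Rle_trans; [apply Rmin_r | apply Rmin_r]).
  set (s := s0 / 2).
  assert (Hms : m * s < e).
  { apply Rle_lt_trans with (Rabs m * s).
    - apply Rmult_le_compat_r; [unfold s; lra | apply Rle_abs].
    - apply Rlt_le_trans with ((Rabs m + 1) * (e / (Rabs m + 1))); [|right; field; lra].
      apply Rmult_le_0_lt_compat; unfold s; lra. }
  destruct (MVT_cor2 (fun t => F (ray p d t)) (fun t => dnormal F d (ray p d t)) s t)
    as (x & Hx & Hx'); [unfold s; lra| |].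
  { intros x Hx. apply is_derive_Reals, is_derive_along.
    apply filter_imp with (2 := HO _ (HrO x ltac:(unfold s in Hx; lra))). exact HF. }
  assert (Hxm : m <= dnormal F d (ray p d x)).
  { assert (H : Rabs (dnormal F d (ray p d x) - l) < l - m) by (apply Hm; unfold s in Hx'; lra).
    apply Rabs_def2 in H. lra. }
  assert (Hxm' : m * (t - s) <= dnormal F d (ray p d x) * (t - s)).
  { apply Rmult_le_compat_r; lra. }
  assert (Hsc : Rabs (F (ray p d s) - c) < e) by (apply Hs; unfold s; lra).
  apply Rabs_def2 in Hsc.
  assert (Htc : F (ray p d t) <= c - kappa * t) by (apply Hray; lra).
  assert (e + e = kappa * t + m * t) by (unfold e; lra).
  lra.
Qed.

(** Along the inward normal the barrier bound drops linearly from [c], so the inward derivative has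
    a negative limit. *)
Lemma hopf (w : R * R -> R) (b p : R * R) (r c g : R) :
  0 < r -> dist2 p b = r ^ 2 -> C2_on (in_disk b r) w ->
  (forall q, in_disk b r q -> pdx (pdx w) q + pdy (pdy w) q = 0) ->
  (forall q, in_disk b r q -> w q < c) ->
  lim_within w (in_disk b r) p c ->
  lim_within (dnormal w ((fst p - fst b) / r, (snd p - snd b) / r)) (in_disk b r) p g ->
  0 < g.
Proof.
  intros Hr Hp HC2 Hlap Hlt Hc Hg.
  destruct (hopf_barrier w b r c Hr HC2 Hlap Hlt) as (kappa & Hk & Hbar).
  set (n := ((fst p - fst b) / r, (snd p - snd b) / r)) in *.
  assert (Hr2 : 0 < r ^ 2) by (apply pow_lt; exact Hr).
  assert (Hdist : forall t, dist2 (ray p (- fst n, - snd n) t) b = (r - t) ^ 2).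
  { intros t.
    replace ((r - t) ^ 2) with ((1 - t / r) ^ 2 * r ^ 2) by (field; lra).
    rewrite <- Hp. unfold dist2, ray, n; simpl. field. lra. }
  assert (H : - g <= - (kappa * r)); [|nra].
  apply (slope_along_ray (in_disk b r) w p (- fst n, - snd n) c _ _ r).
  - apply open_in_disk.
  - intros q Hq. apply (HC2 q Hq).
  - exact Hr.
  - intros t Ht.
    assert (Hi : in_disk b r (ray p (- fst n, - snd n) t)) by (unfold in_disk; rewrite Hdist; nra).
    split; [exact Hi|].
    specialize (Hbar _ Hi). rewrite Hdist in Hbar.
    (* [r ^ 2 - (r - t) ^ 2 = t * (2 * r - t)], which is at least [r * t] for [t < r]; this gives
       the slope [kappa * r]. *)
    assert (kappa * (r * t) <= kappa * (r ^ 2 - (r - t) ^ 2)) by (apply Rmult_le_compat_l; nra).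
    lra.
  - exact Hc.
  - apply lim_within_ext with (fun q => - dnormal w n q).
    + intros q _. symmetry. apply dnormal_opp_r.
    + now apply lim_within_opp.
Qed.

(** * Geometry of the matrix and values on the interfaces *)

Lemma locally_forall_lt (N : nat) (P : nat -> R * R -> Prop) (p : R * R) :
  (forall k, (k < N)%nat -> locally p (P k)) ->
  locally p (fun q => forall k, (k < N)%nat -> P k q).
Proof.
  induction N as [|N IH]; intros H.
  - apply filter_forall. intros q k Hk. lia.
  - assert (H1 : locally p (fun q => forall k, (k < N)%nat -> P k q))
      by (apply IH; intros; apply H; lia).
    apply filter_imp with (2 := filter_and _ _ H1 (H N ltac:(lia))).
    intros q [Hq HN] k Hk. destruct (Nat.eq_dec k N) as [->|Hn]; [exact HN|].
    apply Hq. lia.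
Qed.

Definition translate (m1 m2 : Z) (c : R * R) : R * R := (fst c + IZR m1, snd c + IZR m2).

Lemma dist2_shift (m1 m2 : Z) (q c : R * R) :
  dist2 (shift m1 m2 q) c = dist2 q (translate m1 m2 c).
Proof. unfold dist2, shift, translate; simpl. ring. Qed.

Lemma continuous_dist2_shift (m1 m2 : Z) (c q : R * R) :
  continuous (fun q' => dist2 (shift m1 m2 q') c) q.
Proof.
  apply (continuous_ext (fun q' => dist2 q' (translate m1 m2 c))).
  - intros x. symmetry. apply dist2_shift.
  - apply continuous_dist2.
Qed.

Lemma open_D_copy (a : nat -> R * R) (r : nat -> R) (k : nat) (m1 m2 : Z) :
  open (D_copy a r k m1 m2).
Proof.
  intros q Hq. exact (locally_lt _ _ _ (continuous_dist2_shift m1 m2 (a k) q) Hq).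
Qed.

Lemma open_D_inc_k (a : nat -> R * R) (r : nat -> R) (k : nat) : open (D_inc_k a r k).
Proof.
  intros q (m1 & m2 & Hq).
  apply filter_imp with (2 := open_D_copy a r k m1 m2 q Hq).
  intros q' Hq'. now exists m1, m2.
Qed.

Lemma locally_in_Q00_shift (m1 m2 : Z) (p : R * R) :
  in_Q00 (shift m1 m2 p) -> locally p (fun q => in_Q00 (shift m1 m2 q)).
Proof.
  intros [[H1 H2] [H3 H4]]; simpl in *.
  assert (Cx : continuous (fun q : R * R => fst q) p) by apply continuous_fst.
  assert (Cy : continuous (fun q : R * R => snd q) p) by apply continuous_snd.
  assert (L1 := locally_gt _ p (-1/2 + IZR m1) Cx ltac:(lra)).
  assert (L2 := locally_lt _ p (1/2 + IZR m1) Cx ltac:(lra)).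
  assert (L3 := locally_gt _ p (-1/2 + IZR m2) Cy ltac:(lra)).
  assert (L4 := locally_lt _ p (1/2 + IZR m2) Cy ltac:(lra)).
  apply filter_imp with (2 := filter_and _ _ (filter_and _ _ L1 L2) (filter_and _ _ L3 L4)).
  intros q. unfold in_Q00; simpl. lra.
Qed.

Lemma IZR_dist_lt_1 (m n : Z) : -1 < IZR m - IZR n < 1 -> m = n.
Proof.
  intros [H1 H2]. rewrite <- minus_IZR in H1, H2.
  apply lt_IZR in H1. apply lt_IZR in H2. lia.
Qed.

Lemma exists_cell (x : R) : exists m : Z, -1/2 <= x - IZR m <= 1/2.
Proof.
  exists (up (x - 1/2)). destruct (archimed (x - 1/2)). lra.
Qed.

Lemma Rabs_le_of_dist2 (q c : R * R) (r : R) :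
  0 < r -> dist2 q c <= r ^ 2 ->
  - r <= fst q - fst c <= r /\ - r <= snd q - snd c <= r.
Proof.
  intros Hr H. unfold dist2 in H.
  pose proof (pow2_ge_0 (fst q - fst c)). pose proof (pow2_ge_0 (snd q - snd c)).
  split; split; nra.
Qed.

(* Disjointness puts the centres at distance at least [r + s], so the triangle
   inequality through [p] is an equality. *)
Lemma touching_disks (c1 c2 p : R * R) (r s : R) :
  0 < r -> 0 < s ->
  (forall q, ~ (in_disk c1 r q /\ in_disk c2 s q)) ->
  dist2 p c1 = r ^ 2 -> dist2 p c2 <= s ^ 2 ->
  dist2 p c2 = s ^ 2 /\
  (fst p - fst c2) / s = - ((fst p - fst c1) / r) /\
  (snd p - snd c2) / s = - ((snd p - snd c1) / r).
Proof.
  intros Hr Hs Hdisj H1 H2.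
  assert (Hd : (r + s) ^ 2 <= dist2 c2 c1).
  { apply Rnot_lt_le. intros Hlt.
    set (D := dist2 c2 c1) in *.
    assert (E : 0 < (r + s) ^ 2) by (apply pow_lt; lra).
    (* The point dividing the segment of centres in the ratio [r : s]. Its squared distances to the
       centres are [r ^ 2] and [s ^ 2] times [D / (r + s) ^ 2], so it would lie in both disks. *)
    apply (Hdisj ((s * fst c1 + r * fst c2) / (r + s), (s * snd c1 + r * snd c2) / (r + s))).
    unfold in_disk. split.
    - replace (dist2 _ c1) with (r ^ 2 * (D / (r + s) ^ 2))
        by (unfold D, dist2; simpl; field; lra).
      assert (D / (r + s) ^ 2 < 1) by (apply (Rdiv_lt_1 D); assumption).
      assert (0 < r ^ 2) by (apply pow_lt; lra). nra.
    - replace (dist2 _ c2) with (s ^ 2 * (D / (r + s) ^ 2))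
        by (unfold D, dist2; simpl; field; lra).
      assert (D / (r + s) ^ 2 < 1) by (apply (Rdiv_lt_1 D); assumption).
      assert (0 < s ^ 2) by (apply pow_lt; lra). nra. }
  unfold dist2 in *.
  set (x1 := fst p - fst c1) in *. set (x2 := snd p - snd c1) in *.
  set (y1 := fst p - fst c2) in *. set (y2 := snd p - snd c2) in *.
  replace (fst c2 - fst c1) with (x1 - y1) in Hd by (unfold x1, y1; ring).
  replace (snd c2 - snd c1) with (x2 - y2) in Hd by (unfold x2, y2; ring).
  clearbody x1 x2 y1 y2.
  assert (Hdot : 2 * (x1 * y1 + x2 * y2) <= (y1 ^ 2 + y2 ^ 2) - s ^ 2 - 2 * (r * s)) by lra.
  assert (Hrs : 0 < r * s) by (now apply Rmult_lt_0_compat).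
  assert (Hr2 : 0 < r ^ 2) by (apply pow_lt; lra).
  (* With [x] and [y] the vectors from the two centres to [p], opposite normals mean
     [s x + r y = 0]. The squared length of this vector is bounded by a nonpositive quantity, so
     both vanish, which also puts [p] on the second circle. *)
  assert (Hsum : (s * x1 + r * y1) ^ 2 + (s * x2 + r * y2) ^ 2
     <= - ((r ^ 2 + r * s) * (s ^ 2 - (y1 ^ 2 + y2 ^ 2)))).
  { replace ((s * x1 + r * y1) ^ 2 + (s * x2 + r * y2) ^ 2)
      with (s ^ 2 * (x1 ^ 2 + x2 ^ 2) + r * s * (2 * (x1 * y1 + x2 * y2))
            + r ^ 2 * (y1 ^ 2 + y2 ^ 2)) by ring.
    rewrite H1.
    apply (Rmult_le_compat_l (r * s)) in Hdot; [|lra]. lra. }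
  assert (Hpos : 0 <= (r ^ 2 + r * s) * (s ^ 2 - (y1 ^ 2 + y2 ^ 2)))
    by (apply Rmult_le_pos; lra).
  pose proof (pow2_ge_0 (s * x1 + r * y1)). pose proof (pow2_ge_0 (s * x2 + r * y2)).
  assert (E1 : s * x1 + r * y1 = 0) by (apply Rsqr_0_uniq; rewrite Rsqr_pow2; lra).
  assert (E2 : s * x2 + r * y2 = 0) by (apply Rsqr_0_uniq; rewrite Rsqr_pow2; lra).
  split; [|split].
  - assert (Z : (r ^ 2 + r * s) * (s ^ 2 - (y1 ^ 2 + y2 ^ 2)) = 0) by lra.
    apply Rmult_integral in Z. lra.
  - apply (Rmult_eq_reg_l (r * s)); [|lra].
    replace (r * s * (y1 / s)) with (r * y1) by (field; lra).
    replace (r * s * - (x1 / r)) with (- (s * x1)) by (field; lra). lra.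
  - apply (Rmult_eq_reg_l (r * s)); [|lra].
    replace (r * s * (y2 / s)) with (r * y2) by (field; lra).
    replace (r * s * - (x2 / r)) with (- (s * x2)) by (field; lra). lra.
Qed.

Lemma lim_within_subset (F : R * R -> R) (D D' : R * R -> Prop) (p : R * R) (v : R) :
  (forall q, D' q -> D q) -> lim_within F D p v -> lim_within F D' p v.
Proof.
  intros HD HF P HP. specialize (HF P HP). unfold filtermap, within in *.
  apply filter_imp with (2 := HF). auto.
Qed.

(** The ray in [O] ending at [p] keeps the filter [within O] proper; otherwise every number would be
    a limit. *)
Lemma lim_within_unique (O : R * R -> Prop) (F : R * R -> R) (p d : R * R) (t1 v w : R) :
  0 < t1 -> (forall t, 0 < t < t1 -> O (ray p d t)) ->
  lim_within F O p v -> lim_within F O p w -> v = w.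
Proof.
  intros Ht1 HO Hv Hw. apply NNPP. intros Hvw.
  assert (He : 0 < Rabs (v - w) / 2) by (pose proof (Rabs_pos_lt (v - w)); lra).
  destruct (lim_along_ray O F p d t1 v Ht1 HO Hv _ He) as (t2 & Ht2 & H2).
  destruct (lim_along_ray O F p d t1 w Ht1 HO Hw _ He) as (t3 & Ht3 & H3).
  assert (0 < Rmin t2 t3) by now apply Rmin_pos.
  pose proof (Rmin_l t2 t3). pose proof (Rmin_r t2 t3).
  specialize (H2 (Rmin t2 t3 / 2) ltac:(lra)). specialize (H3 (Rmin t2 t3 / 2) ltac:(lra)).
  set (y := F _) in *. clearbody y.
  assert (Rabs (v - w) <= Rabs (y - v) + Rabs (y - w)); [|lra].
  rewrite (Rabs_minus_sym y v). replace (v - w) with ((v - y) + (y - w)) by ring.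
  apply Rabs_triang.
Qed.

Section Geometry.

Context (N : nat) (a : nat -> R * R) (r : nat -> R).
Context (Hr : forall k, (k < N)%nat -> 0 < r k).
Context (Hin : forall k p, (k < N)%nat -> in_cdisk (a k) (r k) p -> in_Q00 p).

(** A closed disk lies in the open cell, so a point of a closed cell can meet only the disk copies
    belonging to that same cell. In this form the cell sides are no longer special. *)
Lemma D_matrix_iff (p : R * R) :
  D_matrix N a r p <->
  forall k, (k < N)%nat -> forall m1 m2, ~ in_cdisk (a k) (r k) (shift m1 m2 p).
Proof.
  split.
  - intros (n1 & n2 & H) k Hk m1 m2 Hd.
    assert (HQ := Hin k _ Hk Hd).
    assert (E : m1 = n1 /\ m2 = n2).
    { assert (Hn : -1/2 <= fst p - IZR n1 <= 1/2 /\ -1/2 <= snd p - IZR n2 <= 1/2).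
      { destruct H as [[[H H'] _]|(H & H' & _)]; simpl in *; lra. }
      destruct HQ; simpl in *; split; apply IZR_dist_lt_1; lra. }
    destruct E as [-> ->].
    destruct H as [[_ H]|(_ & _ & H)]; [now apply (H k) | tauto].
  - intros H. destruct (exists_cell (fst p)) as [m1 H1]. destruct (exists_cell (snd p)) as [m2 H2].
    exists m1, m2. destruct (classic (in_Q00 (shift m1 m2 p))) as [HQ|HQ].
    + left. split; [exact HQ|]. intros k Hk. now apply H.
    + right. split; [exact H1 | split; [exact H2 | exact HQ]].
Qed.

(** The extreme points of the closed disk in the four axis directions lie in the open square. The
    resulting room [eta] is the same for all lattice copies, which makes the family of copies
    locally finite. *)
Lemma cdisk_margin (k : nat) : (k < N)%nat ->
  exists eta, 0 < eta /\ forall q, in_cdisk (a k) (r k) q ->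
    -1/2 + eta < fst q < 1/2 - eta /\ -1/2 + eta < snd q < 1/2 - eta.
Proof.
  intros Hk. pose proof (Hr k Hk) as Hrk.
  assert (HQ : forall x y, x ^ 2 + y ^ 2 <= r k ^ 2 -> in_Q00 (fst (a k) + x, snd (a k) + y)).
  { intros x y H. apply (Hin k); [exact Hk|]. unfold in_cdisk, dist2; simpl fst; simpl snd.
    replace (fst (a k) + x - fst (a k)) with x by ring.
    now replace (snd (a k) + y - snd (a k)) with y by ring. }
  destruct (HQ (r k) 0 ltac:(lra)) as [[_ A1] _].
  destruct (HQ (- r k) 0 ltac:(nra)) as [[A2 _] _].
  destruct (HQ 0 (r k) ltac:(lra)) as [_ [_ A3]].
  destruct (HQ 0 (- r k) ltac:(nra)) as [_ [A4 _]].
  simpl in *.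
  set (b1 := 1/2 - (fst (a k) + r k)). set (b2 := fst (a k) - r k + 1/2).
  set (b3 := 1/2 - (snd (a k) + r k)). set (b4 := snd (a k) - r k + 1/2).
  exists (Rmin (Rmin b1 b2) (Rmin b3 b4) / 2).
  pose proof (Rmin_l (Rmin b1 b2) (Rmin b3 b4)). pose proof (Rmin_r (Rmin b1 b2) (Rmin b3 b4)).
  pose proof (Rmin_l b1 b2). pose proof (Rmin_r b1 b2).
  pose proof (Rmin_l b3 b4). pose proof (Rmin_r b3 b4).
  assert (0 < Rmin (Rmin b1 b2) (Rmin b3 b4)).
  { repeat apply Rmin_pos; unfold b1, b2, b3, b4; lra. }
  split; [lra|]. intros q Hq.
  destruct (Rabs_le_of_dist2 q (a k) (r k) Hrk Hq).
  unfold b1, b2, b3, b4 in *. lra.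
Qed.

(** Within distance [eta] of [p] only copies whose open cell contains [p] can be met. There is at
    most one such cell, so for each [k] at most one closed disk has to be avoided. *)
Lemma open_D_matrix : open (D_matrix N a r).
Proof.
  intros p Hp. rewrite D_matrix_iff in Hp.
  apply filter_imp with
    (fun q => forall k, (k < N)%nat -> forall m1 m2, ~ in_cdisk (a k) (r k) (shift m1 m2 q)).
  { intros q. apply D_matrix_iff. }
  apply (locally_forall_lt N (fun k q => forall m1 m2, ~ in_cdisk (a k) (r k) (shift m1 m2 q))).
  intros k Hk. destruct (cdisk_margin k Hk) as (eta & Heta & Hm).
  assert (L : locally p (fun q => forall m1 m2, in_cdisk (a k) (r k) (shift m1 m2 q) ->
                              in_Q00 (shift m1 m2 p))).
  { exists (mkposreal eta Heta). intros q [Hx Hy] m1 m2 Hq.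
    change (Rabs (fst q - fst p) < eta) in Hx. change (Rabs (snd q - snd p) < eta) in Hy.
    apply Rabs_def2 in Hx. apply Rabs_def2 in Hy. apply Hm in Hq.
    unfold in_Q00. simpl in *. lra. }
  destruct (classic (exists m1 m2, in_Q00 (shift m1 m2 p))) as [(n1 & n2 & Hn)|Hno].
  - assert (L' : locally p (fun q => r k ^ 2 < dist2 (shift n1 n2 q) (a k))).
    { apply locally_gt; [apply continuous_dist2_shift|].
      apply Rnot_le_lt. exact (Hp k Hk n1 n2). }
    apply filter_imp with (2 := filter_and _ _ L L').
    intros q [H1 H2] m1 m2 Hq. assert (HQ := H1 m1 m2 Hq).
    assert (E : m1 = n1 /\ m2 = n2).
    { destruct HQ, Hn; simpl in *; split; apply IZR_dist_lt_1; lra. }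
    destruct E as [-> ->]. unfold in_cdisk in Hq. lra.
  - apply filter_imp with (2 := L). intros q H m1 m2 Hq. apply Hno.
    exists m1, m2. now apply H.
Qed.

(** Closed disks that miss [p] are avoided for small [t] by continuity, and the ray stays in the
    cell. Only the disks through [p] constrain the direction. *)
Lemma ray_in_D_matrix (k : nat) (m1 m2 : Z) (p d : R * R) :
  (k < N)%nat -> on_interface a r k m1 m2 p ->
  (forall l, (l < N)%nat -> in_cdisk (a l) (r l) (shift m1 m2 p) ->
     forall t, 0 < t -> r l ^ 2 < dist2 (shift m1 m2 (ray p d t)) (a l)) ->
  exists t1, 0 < t1 /\ forall t, 0 < t < t1 -> D_matrix N a r (ray p d t).
Proof.
  intros Hk Hp Hd.
  assert (HQ : in_Q00 (shift m1 m2 p)) by (apply (Hin k _ Hk), Req_le, Hp).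
  assert (L : locally p (fun q => forall l, (l < N)%nat ->
     in_cdisk (a l) (r l) (shift m1 m2 p) \/ ~ in_cdisk (a l) (r l) (shift m1 m2 q))).
  { apply (locally_forall_lt N (fun l q =>
      in_cdisk (a l) (r l) (shift m1 m2 p) \/ ~ in_cdisk (a l) (r l) (shift m1 m2 q))).
    intros l Hl. destruct (classic (in_cdisk (a l) (r l) (shift m1 m2 p))) as [H|H].
    - apply filter_forall. now left.
    - apply filter_imp with (2 := locally_gt _ p _ (continuous_dist2_shift m1 m2 (a l) p)
                                  (Rnot_le_lt _ _ H)).
      intros q Hq. right. unfold in_cdisk. lra. }
  destruct (locally_ray p d _ (filter_and _ _ L (locally_in_Q00_shift m1 m2 p HQ)))
    as (t1 & Ht1 & H).
  exists t1. split; [exact Ht1|]. intros t Ht. destruct (H t Ht) as [H1 H2].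
  exists m1, m2. left. split; [exact H2|]. intros l Hl.
  destruct (H1 l Hl) as [Hc|Hc]; [|exact Hc].
  specialize (Hd l Hl Hc t (proj1 Ht)). unfold in_cdisk. lra.
Qed.

Context (Hdisj : forall j k p, (j < N)%nat -> (k < N)%nat -> j <> k ->
     ~ (in_disk (a j) (r j) p /\ in_disk (a k) (r k) p)).

(** [Hdisj] separates open disks only, so two closed disks may be tangent at [p]. *)
Lemma touching_normal (j k : nat) (m1 m2 : Z) (p : R * R) :
  (j < N)%nat -> (k < N)%nat -> j <> k -> on_interface a r k m1 m2 p ->
  in_cdisk (a j) (r j) (shift m1 m2 p) ->
  on_interface a r j m1 m2 p /\
  normal a r j m1 m2 p = (- fst (normal a r k m1 m2 p), - snd (normal a r k m1 m2 p)).
Proof.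
  intros Hj Hk Hjk Hp Hc.
  destruct (touching_disks (a k) (a j) (shift m1 m2 p) (r k) (r j)) as (H1 & H2 & H3);
    try assumption; try now apply Hr.
  - intros q. apply Hdisj; congruence.
  - split; [exact H1|]. unfold normal. now rewrite H2, H3.
Qed.

Lemma ray_normal_dist2 (k : nat) (m1 m2 : Z) (p : R * R) (t : R) :
  0 < r k -> on_interface a r k m1 m2 p ->
  dist2 (shift m1 m2 (ray p (normal a r k m1 m2 p) t)) (a k) = (r k + t) ^ 2.
Proof.
  intros Hrk Hp.
  replace ((r k + t) ^ 2) with ((1 + t / r k) ^ 2 * r k ^ 2) by (field; lra).
  rewrite <- Hp. unfold dist2, ray, normal, shift; simpl. field. lra.
Qed.

(** By Pythagoras a tangent leaves the disk on both sides of the contact point, so at a contact of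
    two disks it can replace the normal ray. *)
Lemma ray_tangent_dist2 (k : nat) (m1 m2 : Z) (p n : R * R) (t : R) :
  0 < r k -> on_interface a r k m1 m2 p -> normal a r k m1 m2 p = n ->
  dist2 (shift m1 m2 (ray p (- snd n, fst n) t)) (a k) = r k ^ 2 + t ^ 2.
Proof.
  intros Hrk Hp <-.
  replace (r k ^ 2 + t ^ 2) with ((1 + (t / r k) ^ 2) * r k ^ 2) by (field; lra).
  rewrite <- Hp. unfold dist2, ray, normal, shift; simpl. field. lra.
Qed.

(** Convertible to the body of the interface clause of [Lpb], so that clause can be passed directly
    to the lemmas below. *)
Definition interface_data (C : nat -> R) (u : R * R -> R) (uk : nat -> R * R -> R)
  (k : nat) (m1 m2 : Z) (p : R * R) (vu gu wu guk : R) : Prop :=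
  lim_within u (D_matrix N a r) p vu /\
  lim_within (dnormal u (normal a r k m1 m2 p)) (D_matrix N a r) p gu /\
  lim_within (uk k) (D_copy a r k m1 m2) p wu /\
  lim_within (dnormal (uk k) (normal a r k m1 m2 p)) (D_copy a r k m1 m2) p guk /\
  vu = wu /\ gu = / C k * guk.

Context (C : nat -> R) (HC : forall k, (k < N)%nat -> 0 < C k).

(** Hopf's lemma speaks about the inclusion side; the flux condition with [C k > 0] carries the sign
    over to the matrix side. *)
Lemma hopf_interface (u : R * R -> R) (uk : nat -> R * R -> R)
  (k : nat) (m1 m2 : Z) (p : R * R) (c gu wu guk : R) :
  (k < N)%nat -> on_interface a r k m1 m2 p ->
  C2_on (D_inc_k a r k) (uk k) ->
  (forall q, D_inc_k a r k q -> pdx (pdx (uk k)) q + pdy (pdy (uk k)) q = 0) ->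
  (forall q, D_inc_k a r k q -> uk k q < c) ->
  interface_data C u uk k m1 m2 p c gu wu guk -> 0 < gu.
Proof.
  intros Hk Hp HC2 Hlap Hlt (_ & _ & Lw & Lg & <- & ->).
  apply Rmult_lt_0_compat; [now apply Rinv_0_lt_compat, HC|].
  set (b := translate m1 m2 (a k)).
  assert (HD : forall q, in_disk b (r k) q -> D_copy a r k m1 m2 q).
  { intros q Hq. unfold D_copy, in_disk. now rewrite dist2_shift. }
  assert (HI : forall q, in_disk b (r k) q -> D_inc_k a r k q).
  { intros q Hq. exists m1, m2. now apply HD. }
  apply (hopf (uk k) b p (r k) c).
  - now apply Hr.
  - unfold b. rewrite <- dist2_shift. exact Hp.
  - intros q Hq. now apply HC2, HI.
  - intros q Hq. now apply Hlap, HI.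
  - intros q Hq. now apply Hlt, HI.
  - exact (lim_within_subset _ _ _ _ _ HD Lw).
  - apply (lim_within_subset _ _ _ _ _ HD).
    replace (((fst p - fst b) / r k, (snd p - snd b) / r k)) with (normal a r k m1 m2 p); [exact Lg|].
    unfold normal, b, translate, shift; simpl. f_equal; f_equal; ring.
Qed.

(* Hopf's lemma inside the disk gives a positive flux, whereas on the matrix
   side the flux is nonpositive along the normal; where two disks touch there
   may be no normal ray in the matrix, but then Hopf's lemma in both disks gives
   fluxes of opposite orientation that are both positive. *)
Lemma interface_value_lt_sup (u : R * R -> R) (uk : nat -> R * R -> R) (c : R) :
  C1_on (D_matrix N a r) u ->
  (forall k, (k < N)%nat -> C2_on (D_inc_k a r k) (uk k) /\
     forall q, D_inc_k a r k q -> pdx (pdx (uk k)) q + pdy (pdy (uk k)) q = 0) ->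
  (forall k m1 m2 p, (k < N)%nat -> on_interface a r k m1 m2 p ->
     exists vu gu wu guk, interface_data C u uk k m1 m2 p vu gu wu guk) ->
  (forall q, D_matrix N a r q -> u q < c) ->
  (forall k q, (k < N)%nat -> D_inc_k a r k q -> uk k q < c) ->
  forall k m1 m2 p vu gu wu guk, (k < N)%nat -> on_interface a r k m1 m2 p ->
  interface_data C u uk k m1 m2 p vu gu wu guk -> vu <> c.
Proof.
  intros HCu Huk Hint Hltu Hltk k m1 m2 p vu gu wu guk Hk Hp Hdata ->.
  set (n := normal a r k m1 m2 p).
  assert (Hgu : 0 < gu).
  { exact (hopf_interface u uk k m1 m2 p c gu wu guk Hk Hp
      (proj1 (Huk k Hk)) (proj2 (Huk k Hk)) (fun q => Hltk k q Hk) Hdata). }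
  destruct (classic (exists j, (j < N)%nat /\ j <> k /\ in_cdisk (a j) (r j) (shift m1 m2 p)))
    as [(j & Hj & Hjk & Hc)|Hno].
  - destruct (touching_normal j k m1 m2 p Hj Hk Hjk Hp Hc) as [Hpj Hnj]. fold n in Hnj.
    destruct (ray_in_D_matrix k m1 m2 p (- snd n, fst n) Hk Hp) as (t1 & Ht1 & Hray).
    { intros l Hl Hcl t Ht. pose proof (Hr l Hl) as Hrl.
      destruct (Nat.eq_dec l k) as [->|Hlk].
      - rewrite (ray_tangent_dist2 k m1 m2 p n); [nra | assumption | assumption | reflexivity].
      - destruct (touching_normal l k m1 m2 p Hl Hk Hlk Hp Hcl) as [Hpl Hnl]. fold n in Hnl.
        (* Any other disk through [p] has normal [- n]. Its tangent direction is reversed, so the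
           point at parameter [t] is its tangent point at [- t]. *)
        replace (dist2 _ _) with (r l ^ 2 + (- t) ^ 2); [nra|].
        rewrite <- (ray_tangent_dist2 l m1 m2 p _ (- t) Hrl Hpl Hnl).
        unfold ray; simpl. f_equal. f_equal. f_equal; ring. }
    (* The data of disk [j] contain limits of the same [u] within the same matrix at the same point.
       Uniqueness along the tangent ray identifies the value with [c] and the flux with [- gu]. *)
    destruct (Hint j m1 m2 p Hj Hpj) as (vj & gj & wj & gkj & Hdj).
    assert (vj = c).
    { eapply lim_within_unique; [exact Ht1 | exact Hray | apply Hdj | apply Hdata]. }
    subst vj.
    assert (Hgj : 0 < gj).
    { exact (hopf_interface u uk j m1 m2 p c gj wj gkj Hj Hpj
        (proj1 (Huk j Hj)) (proj2 (Huk j Hj)) (fun q => Hltk j q Hj) Hdj). }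
    assert (gj = - gu); [|lra].
    eapply lim_within_unique; [exact Ht1 | exact Hray | apply Hdj |].
    apply lim_within_ext with (fun q => - dnormal u n q).
    + intros q _. rewrite Hnj. symmetry. apply dnormal_opp_r.
    + apply lim_within_opp, Hdata.
  - destruct (ray_in_D_matrix k m1 m2 p n Hk Hp) as (t1 & Ht1 & Hray).
    { intros l Hl Hcl t Ht. destruct (Nat.eq_dec l k) as [->|Hlk].
      - unfold n. pose proof (Hr k Hk). rewrite ray_normal_dist2; [nra | assumption | assumption].
      - exfalso. apply Hno. now exists l. }
    (* The bound [u < c] along the outward normal is the case of slope 0. *)
    assert (gu <= - 0); [|lra].
    apply (slope_along_ray (D_matrix N a r) u p n c 0 gu t1); try apply Hdata.
    + exact open_D_matrix.
    + exact HCu.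
    + exact Ht1.
    + intros t Ht. split; [now apply Hray|].
      specialize (Hltu _ (Hray t Ht)). lra.
Qed.

(** Negating [u] and all [uk] preserves the equations and the interface conditions and turns the
    lower bound into an upper one. *)
Lemma interface_value_gt_inf (u : R * R -> R) (uk : nat -> R * R -> R) (c : R) :
  C2_on (D_matrix N a r) u ->
  (forall k, (k < N)%nat -> C2_on (D_inc_k a r k) (uk k) /\
     forall q, D_inc_k a r k q -> pdx (pdx (uk k)) q + pdy (pdy (uk k)) q = 0) ->
  (forall k m1 m2 p, (k < N)%nat -> on_interface a r k m1 m2 p ->
     exists vu gu wu guk, interface_data C u uk k m1 m2 p vu gu wu guk) ->
  (forall q, D_matrix N a r q -> c < u q) ->
  (forall k q, (k < N)%nat -> D_inc_k a r k q -> c < uk k q) ->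
  forall k m1 m2 p vu gu wu guk, (k < N)%nat -> on_interface a r k m1 m2 p ->
  interface_data C u uk k m1 m2 p vu gu wu guk -> vu <> c.
Proof.
  intros HCu Huk Hint Hltu Hltk k m1 m2 p vu gu wu guk Hk Hp Hdata Hvu.
  assert (Hopp : forall O F, open O -> C2_on O F -> C2_on O (fun q => - F q)).
  { intros O F HO HF.
    refine (proj1 (C2_on_comp O HO Ropp (fun _ => -1) (fun _ => 0) F _ _ _ HF));
      [|reflexivity].
    intros q _. split; [|split].
    - auto_derive; [exact I | ring].
    - auto_derive; [exact I | ring].
    - apply continuous_const. }
  assert (Hdopp : forall k m1 m2 p vu gu wu guk, interface_data C u uk k m1 m2 p vu gu wu guk ->
    interface_data C (fun q => - u q) (fun k q => - uk k q) k m1 m2 p (- vu) (- gu) (- wu) (- guk)).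
  { clear. intros k m1 m2 p vu gu wu guk (H1 & H2 & H3 & H4 & -> & ->).
    split; [|split; [|split; [|split; [|split]]]].
    - now apply lim_within_opp.
    - apply lim_within_ext with (fun q => - dnormal u (normal a r k m1 m2 p) q).
      + intros. symmetry. apply dnormal_opp.
      + now apply lim_within_opp.
    - now apply lim_within_opp.
    - apply lim_within_ext with (fun q => - dnormal (uk k) (normal a r k m1 m2 p) q).
      + intros. symmetry. apply dnormal_opp.
      + now apply lim_within_opp.
    - reflexivity.
    - ring. }
  refine (interface_value_lt_sup (fun q => - u q) (fun k q => - uk k q) (- c)
    _ _ _ _ _ k m1 m2 p (- vu) (- gu) (- wu) (- guk) Hk Hp (Hdopp _ _ _ _ _ _ _ _ Hdata) _).
  - exact (proj1 (proj1 (C2_on_C1 _ _) (Hopp _ _ open_D_matrix HCu))).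
  - intros l Hl. destruct (Huk l Hl) as [H1 H2].
    split; [apply Hopp; [apply open_D_inc_k | exact H1]|].
    intros q Hq.
    rewrite (pdx_ext_on _ (open_D_inc_k a r l) _ (fun q => - pdx (uk l) q)),
            (pdy_ext_on _ (open_D_inc_k a r l) _ (fun q => - pdy (uk l) q));
      try assumption; try (intros; apply pdx_opp || apply pdy_opp).
    rewrite pdx_opp, pdy_opp. specialize (H2 q Hq). lra.
  - intros l n1 n2 q Hl Hq. destruct (Hint l n1 n2 q Hl Hq) as (v & g & w & gk & H).
    do 4 eexists. apply Hdopp. exact H.
  - intros q Hq. specialize (Hltu q Hq). lra.
  - intros l q Hl Hq. specialize (Hltk l q Hl Hq). lra.
  - now rewrite Hvu.
Qed.

End Geometry.

(** * The Kirchhoff transform *)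

Section Inverse.

Context (g g1 : R -> R).
Context (Dg : forall t, is_derive g t (g1 t)) (Hg1 : forall t, 0 < g1 t).

Lemma continuous_of_derive (t : R) : continuous g t.
Proof. apply (ex_derive_continuous (V := R_NormedModule)). eexists; apply Dg. Qed.

Lemma increasing_of_derive_pos (s t : R) : s < t -> g s < g t.
Proof.
  intros Hst. destruct (MVT_cor2 g g1 s t Hst) as (c & Hc & _).
  { intros c _. apply is_derive_Reals, Dg. }
  specialize (Hg1 c). nra.
Qed.

Lemma inv_fun_right (y : R) : (exists t, g t = y) -> g (inv_fun g y) = y.
Proof. apply (epsilon_spec (inhabits 0)). Qed.

Lemma inv_fun_left (t : R) : inv_fun g (g t) = t.
Proof.
  assert (E := inv_fun_right (g t) (ex_intro _ t eq_refl)).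
  destruct (Rtotal_order (inv_fun g (g t)) t) as [H|[H|H]]; [|exact H|];
    apply increasing_of_derive_pos in H; lra.
Qed.

Lemma value_between (s t y : R) : g s <= y <= g t -> exists x, g x = y.
Proof.
  intros H. destruct (IVT_gen_consistent g s t y) as (x & _ & Hx).
  - exact continuous_of_derive.
  - rewrite Rmin_left, Rmax_right; lra.
  - now exists x.
Qed.

(** The range of [g] is an interval by the intermediate value theorem, so a missed value lies
    entirely on one side of it. *)
Lemma not_value_cases (y : R) :
  (exists t, g t = y) \/ (forall t, g t < y) \/ (forall t, y < g t).
Proof.
  destruct (classic (exists t, g t <= y)) as [[s Hs]|Hs].
  - destruct (classic (exists t, y <= g t)) as [[t Ht]|Ht].
    + left. now apply (value_between s t).
    + right; left. intros t. apply Rnot_le_lt. intros H. apply Ht. now exists t.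
  - right; right. intros t. apply Rnot_le_lt. intros H. apply Hs. now exists t.
Qed.

Lemma continuous_inv_fun (t : R) : continuous (inv_fun g) (g t).
Proof.
  intros P [e He]. rewrite inv_fun_left in He.
  pose proof (cond_pos e) as Hpos.
  assert (H1 : g (t - e / 2) < g t) by (apply increasing_of_derive_pos; lra).
  assert (H2 : g t < g (t + e / 2)) by (apply increasing_of_derive_pos; lra).
  apply filter_imp with (2 := filter_and _ _
    (locally_gt (fun y => y) (g t) _ (continuous_id _) H1)
    (locally_lt (fun y => y) (g t) _ (continuous_id _) H2)).
  intros y [Hy1 Hy2].
  destruct (value_between (t - e / 2) (t + e / 2) y) as [x <-]; [lra|].
  rewrite inv_fun_left. apply He. change (Rabs (x - t) < e). apply Rabs_def1.
  - apply Rnot_le_lt. intros H.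
    assert (g (t + e / 2) < g x) by (apply increasing_of_derive_pos; lra). lra.
  - apply Rnot_le_lt. intros H.
    assert (g x < g (t - e / 2)) by (apply increasing_of_derive_pos; lra). lra.
Qed.

(** [inv_fun g] is arbitrary off the range of [g], so its differentiability at [g t] needs the range
    to be a neighbourhood of [g t]. *)
Lemma locally_value (t : R) : locally (g t) (fun y => exists x, g x = y).
Proof.
  assert (H1 : g (t - 1) < g t) by (apply increasing_of_derive_pos; lra).
  assert (H2 : g t < g (t + 1)) by (apply increasing_of_derive_pos; lra).
  apply filter_imp with (2 := filter_and _ _
    (locally_gt (fun y => y) (g t) _ (continuous_id _) H1)
    (locally_lt (fun y => y) (g t) _ (continuous_id _) H2)).
  intros y [Hy1 Hy2]. apply (value_between (t - 1) (t + 1)). lra.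
Qed.

(** By the mean value theorem [x - t] is [(g x - g t) / g1 c] with [c] between [t] and [x], so the
    error is [g x - g t] times a difference of [/ g1] at [c] and [t], which is small by
    continuity. *)
Lemma is_derive_inv_fun (t : R) :
  continuous g1 t -> is_derive (inv_fun g) (g t) (/ g1 t).
Proof.
  intros Cg1. split; [apply is_linear_scal_l|].
  intros y0 Hy0 eps. rewrite <- (is_filter_lim_locally_unique _ _ Hy0). clear y0 Hy0.
  pose proof (cond_pos eps) as Heps. pose proof (Hg1 t) as Ht.
  assert (Cinv : continuous (fun x => / g1 x) t)
    by (apply continuous_Rinv_comp; [exact Cg1 | lra]).
  assert (L : locally t (fun x => Rabs (/ g1 x - / g1 t) < eps)).
  { apply (Cinv (fun v => Rabs (v - / g1 t) < eps)). now exists eps. }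
  destruct L as [d Hd].
  assert (L : locally (g t) (fun y => Rabs (inv_fun g y - t) < d)).
  { apply (continuous_inv_fun t (fun v => Rabs (v - t) < d)). rewrite inv_fun_left. now exists d. }
  apply filter_imp with (2 := filter_and _ _ L (locally_value t)).
  intros y [Hy [x <-]]. rewrite inv_fun_left in Hy |- *. rewrite inv_fun_left.
  change (Rabs ((x - t) - (g x - g t) * / g1 t) <= eps * Rabs (g x - g t)).
  destruct (MVT_gen g t x g1) as (c & Hc & E).
  - intros; apply Dg.
  - intros z _. apply continuity_pt_filterlim. exact (continuous_of_derive z).
  - assert (Hcd : Rabs (c - t) < d).
    { apply Rle_lt_trans with (2 := Hy). unfold Rmin, Rmax in Hc.
      destruct (Rle_dec t x).
      - rewrite !Rabs_pos_eq; lra.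
      - rewrite !Rabs_left1; lra. }
    replace (x - t) with ((g x - g t) * / g1 c)
      by (rewrite E; field; apply Rgt_not_eq, Hg1).
    rewrite <- Rmult_minus_distr_l, Rabs_mult, Rmult_comm.
    apply Rmult_le_compat_r; [apply Rabs_pos|].
    apply Rlt_le. exact (Hd c Hcd).
Qed.

End Inverse.

Lemma smooth_continuous (g : R -> R) (x : R) : smooth g -> continuous g x.
Proof.
  intros Hg. apply (ex_derive_continuous (V := R_NormedModule)). exact (Hg 1%nat x).
Qed.

Lemma is_derive_kirchhoff (g : R -> R) (t : R) :
  smooth g -> is_derive (kirchhoff g) t (g t).
Proof.
  intros Hg. apply (is_derive_RInt g _ 0).
  - apply filter_forall. intros x. apply (RInt_correct (V := R_CompleteNormedModule)).
    apply (ex_RInt_continuous (V := R_CompleteNormedModule)).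
    intros z _. now apply smooth_continuous.
  - now apply smooth_continuous.
Qed.

Lemma kirchhoff_scal (g h : R -> R) (c t : R) :
  smooth h -> (forall x, g x = c * h x) -> kirchhoff g t = c * kirchhoff h t.
Proof.
  intros Hh E. unfold kirchhoff.
  rewrite (RInt_ext g (fun x => c * h x)) by (intros; apply E).
  apply (RInt_scal (V := R_CompleteNormedModule) h).
  apply (ex_RInt_continuous (V := R_CompleteNormedModule)).
  intros z _. now apply smooth_continuous.
Qed.

Section Kirchhoff.

Context (lam : R -> R) (Hlam : smooth lam) (Hpos : forall t, 0 < lam t).

Let K := kirchhoff lam.
Let G := inv_fun K.

Lemma kirchhoff_derive (t : R) : is_derive K t (lam t).
Proof. now apply is_derive_kirchhoff. Qed.

Lemma inv_kirchhoff_kirchhoff (t : R) : G (K t) = t.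
Proof. exact (inv_fun_left K lam kirchhoff_derive Hpos t). Qed.

Lemma derive_inv_kirchhoff (t : R) : is_derive G (K t) (/ lam t).
Proof.
  apply (is_derive_inv_fun K lam kirchhoff_derive Hpos). now apply smooth_continuous.
Qed.

Lemma C2_on_kirchhoff (O : R * R -> Prop) (F H : R * R -> R) :
  open O -> (forall q, O q -> H q = K (F q)) ->
  C2_on O F ->
  C2_on O H /\
  forall p, O p -> pdx H p = lam (F p) * pdx F p /\ pdy H p = lam (F p) * pdy F p.
Proof.
  intros HO E. apply (C2_on_comp O HO K lam (Derive lam)); [|exact E].
  intros p _. split; [|split].
  - apply kirchhoff_derive.
  - apply Derive_correct. exact (Hlam 1%nat _).
  - apply (ex_derive_continuous (V := R_NormedModule)). exact (Hlam 2%nat _).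
Qed.

Lemma C2_on_inv_kirchhoff (O : R * R -> Prop) (F H : R * R -> R) :
  open O -> (forall q, O q -> H q = K (F q)) ->
  C2_on O H -> C2_on O F.
Proof.
  intros HO E HH.
  assert (CG : forall t, continuous G (K t)).
  { intros t. apply (ex_derive_continuous (V := R_NormedModule)).
    eexists. apply derive_inv_kirchhoff. }
  assert (EF : forall q, O q -> F q = G (H q)).
  { intros q Hq. rewrite (E q Hq). symmetry. apply inv_kirchhoff_kirchhoff. }
  (* The two functions are [G'] and [G'' = - lam'(G) / lam(G) ^ 3]; the latter is written as a
     product of inverses so that its continuity reduces to that of the factors. *)
  refine (proj1 (C2_on_comp O HO G (fun y => / lam (G y))
    (fun y => - (Derive lam (G y) * / lam (G y)) * / lam (G y) * / lam (G y)) H F _ EF HH)).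
  intros p Hp. rewrite (E p Hp). set (t := F p).
  pose proof (Hpos t) as Ht.
  assert (CL : continuous (fun y => / lam (G y)) (K t)).
  { apply continuous_Rinv_comp; [|rewrite inv_kirchhoff_kirchhoff; lra].
    apply (continuous_comp G lam); [apply CG | now apply smooth_continuous]. }
  split; [|split].
  - rewrite inv_kirchhoff_kirchhoff. apply derive_inv_kirchhoff.
  - rewrite inv_kirchhoff_kirchhoff.
    replace (- (Derive lam t * / lam t) * / lam t * / lam t)
      with (- (Derive lam (G (K t)) * / lam t) / lam (G (K t)) ^ 2)
      by (rewrite inv_kirchhoff_kirchhoff; field; lra).
    apply (is_derive_inv (fun y => lam (G y))); [|rewrite inv_kirchhoff_kirchhoff; lra].
    rewrite Rmult_comm.
    apply (is_derive_comp lam G); [|apply derive_inv_kirchhoff].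
    apply Derive_correct. exact (Hlam 1%nat _).
  - apply (continuous_mult (K := R_AbsRing)); [|exact CL].
    apply (continuous_mult (K := R_AbsRing)); [|exact CL].
    apply (continuous_opp (V := R_NormedModule)).
    apply (continuous_mult (K := R_AbsRing)); [|exact CL].
    apply (continuous_comp G (Derive lam)); [apply CG|].
    apply (ex_derive_continuous (V := R_NormedModule)). exact (Hlam 2%nat _).
Qed.

End Kirchhoff.

(** * Transfer of each condition between (NL) and (L) *)

Section Equivalence.

Context (N : nat) (a : nat -> R * R) (r : nat -> R)
  (lam : R -> R) (lamk : nat -> R -> R) (C : nat -> R) (A th : R)
  (q1p q1m q2p q2m : R -> Z -> Z -> R).
Context (Hr : forall k, (k < N)%nat -> 0 < r k)
  (Hin : forall k p, (k < N)%nat -> in_cdisk (a k) (r k) p -> in_Q00 p)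
  (Hdisj : forall j k p, (j < N)%nat -> (k < N)%nat -> j <> k ->
     ~ (in_disk (a j) (r j) p /\ in_disk (a k) (r k) p))
  (Hlam : smooth lam) (Hpos : forall t, 0 < lam t)
  (HC : forall k, (k < N)%nat -> 0 < C k)
  (Hprop : forall k t, (k < N)%nat -> lam t = C k * lamk k t).
Context (T u : R * R -> R) (Tk uk : nat -> R * R -> R)
  (Hu : forall p, D_matrix N a r p -> u p = kirchhoff lam (T p))
  (Huk : forall k p, (k < N)%nat -> D_inc_k a r k p -> uk k p = kirchhoff lam (Tk k p)).

Lemma lamk_eq (k : nat) (t : R) : (k < N)%nat -> lamk k t = / C k * lam t.
Proof. intros Hk. rewrite (Hprop k t Hk). specialize (HC k Hk). field. lra. Qed.

Lemma side_y_in_D_matrix (m1 m2 : Z) (x s : R) :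
  -1/2 < x < 1/2 -> s = 1/2 \/ s = -1/2 -> D_matrix N a r (IZR m1 + x, IZR m2 + s).
Proof.
  intros Hx Hs. exists m1, m2. right. unfold on_bdQ00, in_Q00; simpl. lra.
Qed.

Lemma side_x_in_D_matrix (m1 m2 : Z) (y s : R) :
  -1/2 < y < 1/2 -> s = 1/2 \/ s = -1/2 -> D_matrix N a r (IZR m1 + s, IZR m2 + y).
Proof.
  intros Hx Hs. exists m1, m2. right. unfold on_bdQ00, in_Q00; simpl. lra.
Qed.

(** The fields [lam(T) grad T] and [grad u] coincide on an open set, so their divergences agree
    without expanding the product. *)
Lemma pde_matrix_eq :
  C2_on (D_matrix N a r) T -> forall p, D_matrix N a r p ->
  pdx (fun q => lam (T q) * pdx T q) p + pdy (fun q => lam (T q) * pdy T q) p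
  = pdx (pdx u) p + pdy (pdy u) p.
Proof.
  intros HT p Hp. pose proof (open_D_matrix N a r Hr Hin) as HO.
  destruct (C2_on_kirchhoff lam Hlam _ T u HO Hu HT) as [_ HD].
  f_equal; symmetry.
  - apply (pdx_ext_on _ HO); [|exact Hp]. intros q Hq. now apply HD.
  - apply (pdy_ext_on _ HO); [|exact Hp]. intros q Hq. now apply HD.
Qed.

Lemma pde_inclusion_eq (k : nat) : (k < N)%nat ->
  C2_on (D_inc_k a r k) (Tk k) -> forall p, D_inc_k a r k p ->
  pdx (fun q => lamk k (Tk k q) * pdx (Tk k) q) p
    + pdy (fun q => lamk k (Tk k q) * pdy (Tk k) q) p
  = / C k * (pdx (pdx (uk k)) p + pdy (pdy (uk k)) p).
Proof.
  intros Hk HT p Hp. pose proof (open_D_inc_k a r k) as HO.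
  destruct (C2_on_kirchhoff lam Hlam _ (Tk k) (uk k) HO (fun q => Huk k q Hk) HT) as [_ HD].
  rewrite Rmult_plus_distr_l. f_equal.
  - rewrite (pdx_ext_on _ HO _ (fun q => / C k * pdx (uk k) q)); [|intros q Hq|exact Hp].
    + exact (Derive_scal (fun t => pdx (uk k) (t, snd p)) (/ C k) (fst p)).
    + rewrite lamk_eq by exact Hk. rewrite (proj1 (HD q Hq)). ring.
  - rewrite (pdy_ext_on _ HO _ (fun q => / C k * pdy (uk k) q)); [|intros q Hq|exact Hp].
    + exact (Derive_scal (fun t => pdy (uk k) (fst p, t)) (/ C k) (snd p)).
    + rewrite lamk_eq by exact Hk. rewrite (proj2 (HD q Hq)). ring.
Qed.

(** Two sets occur because, on the inclusion side, the limit is taken within one copy [D] while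
    regularity is known on the union [O] of all copies. *)
Lemma lim_kirchhoff (D O : R * R -> Prop) (F H : R * R -> R) (n p : R * R) (v g : R) :
  (forall q, D q -> O q) -> open O -> (forall q, O q -> H q = kirchhoff lam (F q)) ->
  C2_on O F ->
  lim_within F D p v -> lim_within (dnormal F n) D p g ->
  lim_within H D p (kirchhoff lam v) /\ lim_within (dnormal H n) D p (lam v * g).
Proof.
  intros HDO HO E HF Lv Lg.
  destruct (C2_on_kirchhoff lam Hlam O F H HO E HF) as [_ HD].
  split.
  - apply lim_within_ext with (fun q => kirchhoff lam (F q)).
    + intros q Hq. symmetry. auto.
    + apply lim_within_comp; [|exact Lv].
      exact (continuous_of_derive _ _ (fun t => kirchhoff_derive lam Hlam t) v).
  - apply lim_within_ext with (fun q => lam (F q) * dnormal F n q).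
    + intros q Hq. unfold dnormal. destruct (HD q (HDO q Hq)) as [-> ->]. ring.
    + apply lim_within_mult; [|exact Lg].
      apply lim_within_comp; [now apply smooth_continuous | exact Lv].
Qed.

(** The limit of [H] is required to be a value of the transform: only there is the inverse known to
    be continuous. *)
Lemma lim_inv_kirchhoff (D O : R * R -> Prop) (F H : R * R -> R) (n p : R * R) (t g : R) :
  (forall q, D q -> O q) -> open O -> (forall q, O q -> H q = kirchhoff lam (F q)) ->
  C2_on O F ->
  lim_within H D p (kirchhoff lam t) -> lim_within (dnormal H n) D p g ->
  lim_within F D p t /\ lim_within (dnormal F n) D p (/ lam t * g).
Proof.
  intros HDO HO E HF Lv Lg.
  destruct (C2_on_kirchhoff lam Hlam O F H HO E HF) as [_ HD].
  assert (LF : lim_within F D p t).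
  { apply lim_within_ext with (fun q => inv_fun (kirchhoff lam) (H q)).
    - intros q Hq. rewrite E by auto. now apply inv_kirchhoff_kirchhoff.
    - rewrite <- (inv_kirchhoff_kirchhoff lam Hlam Hpos t).
      apply lim_within_comp; [|exact Lv].
      apply (ex_derive_continuous (V := R_NormedModule)).
      eexists. now apply derive_inv_kirchhoff. }
  split; [exact LF|].
  apply lim_within_ext with (fun q => / lam (F q) * dnormal H n q).
  - intros q Hq. unfold dnormal. destruct (HD q (HDO q Hq)) as [-> ->].
    specialize (Hpos (F q)). field. lra.
  - apply lim_within_mult; [|exact Lg].
    apply (lim_within_comp (fun t => / lam t)); [|exact LF].
    apply continuous_Rinv_comp; [now apply smooth_continuous | apply Rgt_not_eq, Hpos].
Qed.

(** The two families of functions are tied only by [Hu] and [Huk] on their domains, so one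
    equivalence serves both when [u] is built from [T] and when [T] is recovered from [u]. *)
Lemma NL_iff_Lpb :
  NL N a r lam lamk A th q1p q1m q2p q2m T Tk <->
  Lpb N a r C A th q1p q1m q2p q2m u uk.
Proof.
  pose proof (open_D_matrix N a r Hr Hin) as HO.
  assert (HDk : forall k m1 m2 q, D_copy a r k m1 m2 q -> D_inc_k a r k q).
  { intros k m1 m2 q Hq. now exists m1, m2. }
  split.
  - intros (HT & HpT & HTk & Hy & Hx & Hint).
    destruct (C2_on_kirchhoff lam Hlam _ T u HO Hu HT) as [HCu HD].
    split; [|split; [|split; [|split; [|split]]]].
    + exact HCu.
    + intros p Hp. rewrite <- pde_matrix_eq by assumption. auto.
    + intros k Hk. destruct (HTk k Hk) as [HTk2 HpTk]. split.
      * now apply (C2_on_kirchhoff lam Hlam _ (Tk k) (uk k) (open_D_inc_k a r k)); auto.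
      * intros p Hp. specialize (HpTk p Hp).
        rewrite (pde_inclusion_eq k Hk HTk2 p Hp) in HpTk.
        apply Rmult_integral in HpTk. destruct HpTk as [H|H]; [|exact H].
        exfalso. exact (Rinv_neq_0_compat _ (Rgt_not_eq _ _ (HC k Hk)) H).
    + intros m1 m2 x Hx'. destruct (Hy m1 m2 x Hx') as [H1 H2].
      split; [rewrite (proj2 (HD _ (side_y_in_D_matrix m1 m2 x (1/2) Hx' ltac:(lra)))); exact H1|].
      rewrite <- H2. apply HD.
      replace (IZR m2 - 1/2) with (IZR m2 + -1/2) by lra.
      apply side_y_in_D_matrix; lra.
    + intros m1 m2 y Hy'. destruct (Hx m1 m2 y Hy') as [H1 H2].
      split; [rewrite (proj1 (HD _ (side_x_in_D_matrix m1 m2 y (1/2) Hy' ltac:(lra)))); exact H1|].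
      rewrite <- H2. apply HD.
      replace (IZR m1 - 1/2) with (IZR m1 + -1/2) by lra.
      apply side_x_in_D_matrix; lra.
    + intros k m1 m2 p Hk Hp.
      destruct (Hint k m1 m2 p Hk Hp) as (v & g & w & gk & L1 & L2 & L3 & L4 & <- & E).
      destruct (lim_kirchhoff _ _ T u _ p v g (fun _ H => H) HO Hu HT L1 L2) as [M1 M2].
      destruct (lim_kirchhoff _ _ (Tk k) (uk k) _ p v gk (HDk k m1 m2) (open_D_inc_k a r k)
        (fun q => Huk k q Hk) (proj1 (HTk k Hk)) L3 L4) as [M3 M4].
      exists (kirchhoff lam v), (lam v * g), (kirchhoff lam v), (lam v * gk).
      repeat (split; [assumption|]). split; [reflexivity|].
      rewrite E, lamk_eq by exact Hk. ring.
  - intros (HCu & Hpu & Hpuk & Hy & Hx & Hint).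
    assert (HT := C2_on_inv_kirchhoff lam Hlam Hpos _ T u HO Hu HCu).
    destruct (C2_on_kirchhoff lam Hlam _ T u HO Hu HT) as [_ HD].
    assert (HTk : forall k, (k < N)%nat -> C2_on (D_inc_k a r k) (Tk k)).
    { intros k Hk. apply (C2_on_inv_kirchhoff lam Hlam Hpos _ (Tk k) (uk k));
        [apply open_D_inc_k | intros; now apply Huk | now apply Hpuk]. }
    split; [|split; [|split; [|split; [|split]]]].
    + exact HT.
    + intros p Hp. rewrite pde_matrix_eq by assumption. auto.
    + intros k Hk. split; [now apply HTk|]. intros p Hp.
      rewrite (pde_inclusion_eq k Hk (HTk k Hk) p Hp).
      rewrite (proj2 (Hpuk k Hk) p Hp). ring.
    + intros m1 m2 x Hx'. destruct (Hy m1 m2 x Hx') as [H1 H2].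
      split; [rewrite <- (proj2 (HD _ (side_y_in_D_matrix m1 m2 x (1/2) Hx' ltac:(lra)))); exact H1|].
      rewrite <- H2. symmetry. apply HD.
      replace (IZR m2 - 1/2) with (IZR m2 + -1/2) by lra.
      apply side_y_in_D_matrix; lra.
    + intros m1 m2 y Hy'. destruct (Hx m1 m2 y Hy') as [H1 H2].
      split; [rewrite <- (proj1 (HD _ (side_x_in_D_matrix m1 m2 y (1/2) Hy' ltac:(lra)))); exact H1|].
      rewrite <- H2. symmetry. apply HD.
      replace (IZR m1 - 1/2) with (IZR m1 + -1/2) by lra.
      apply side_x_in_D_matrix; lra.
    + intros k m1 m2 p Hk Hp.
      destruct (Hint k m1 m2 p Hk Hp) as (v & g & w & gk & Hdata).
      assert (Hv : exists t, kirchhoff lam t = v).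
      { destruct (not_value_cases _ _ (kirchhoff_derive lam Hlam) v) as [H|[H|H]];
          [exact H | exfalso | exfalso].
        - refine (interface_value_lt_sup N a r Hr Hin Hdisj C HC u uk v _ Hpuk Hint _ _
            k m1 m2 p v g w gk Hk Hp Hdata eq_refl).
          + exact (proj1 (proj1 (C2_on_C1 _ _) HCu)).
          + intros q Hq. rewrite Hu by exact Hq. apply H.
          + intros l q Hl Hq. rewrite Huk by assumption. apply H.
        - refine (interface_value_gt_inf N a r Hr Hin Hdisj C HC u uk v HCu Hpuk Hint _ _
            k m1 m2 p v g w gk Hk Hp Hdata eq_refl).
          + intros q Hq. rewrite Hu by exact Hq. apply H.
          + intros l q Hl Hq. rewrite Huk by assumption. apply H. }
      destruct Hv as [t <-]. destruct Hdata as (L1 & L2 & L3 & L4 & <- & ->).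
      destruct (lim_inv_kirchhoff _ _ T u _ p t _ (fun _ H => H) HO Hu HT L1 L2) as [M1 M2].
      destruct (lim_inv_kirchhoff _ _ (Tk k) (uk k) _ p t gk (HDk k m1 m2) (open_D_inc_k a r k)
        (fun q => Huk k q Hk) (HTk k Hk) L3 L4) as [M3 M4].
      do 4 eexists. split; [exact M1 | split; [exact M2 | split; [exact M3 | split; [exact M4|]]]].
      split; [reflexivity|].
      rewrite lamk_eq by exact Hk. ring.
Qed.

End Equivalence.

Theorem theorem1 (N : nat) (a : nat -> R * R) (r : nat -> R)
  (lam : R -> R) (lamk : nat -> R -> R) (C : nat -> R) (A th : R)
  (q1p q1m q2p q2m : R -> Z -> Z -> R) :
  (* geometry: disks with closures inside Q_(0,0), mutually disjoint *)
  (forall k, (k < N)%nat -> 0 < r k) ->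
  (forall k p, (k < N)%nat -> in_cdisk (a k) (r k) p -> in_Q00 p) ->
  (forall j k p, (j < N)%nat -> (k < N)%nat -> j <> k ->
     ~ (in_disk (a j) (r j) p /\ in_disk (a k) (r k) p)) ->
  (* conductivities *)
  smooth lam -> (forall t, 0 < lam t) ->
  (forall k, (k < N)%nat -> smooth (lamk k) /\ forall t, 0 < lamk k t) ->
  (* proportionality assumption *)
  (forall k, (k < N)%nat -> 0 < C k) ->
  (forall k t, (k < N)%nat -> lam t = C k * lamk k t) ->
  (forall (T : R * R -> R) (Tk : nat -> R * R -> R),
     NL N a r lam lamk A th q1p q1m q2p q2m T Tk <->
     Lpb N a r C A th q1p q1m q2p q2m
       (fun p => kirchhoff lam (T p))
       (fun k p => C k * kirchhoff (lamk k) (Tk k p)))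
  /\
  (forall (u : R * R -> R) (uk : nat -> R * R -> R),
     Lpb N a r C A th q1p q1m q2p q2m u uk ->
     (forall p, D_matrix N a r p -> exists t, kirchhoff lam t = u p) ->
     (forall k p, (k < N)%nat -> D_inc_k a r k p ->
        exists t, kirchhoff (lamk k) t = uk k p / C k) ->
     NL N a r lam lamk A th q1p q1m q2p q2m
       (fun p => inv_fun (kirchhoff lam) (u p))
       (fun k p => inv_fun (kirchhoff (lamk k)) (uk k p / C k))).
Proof.
  intros Hr Hin Hdisj Hlam Hpos Hlamk HC Hprop.
  assert (HK : forall k t, (k < N)%nat -> kirchhoff lam t = C k * kirchhoff (lamk k) t).
  { intros k t Hk. apply kirchhoff_scal; [now apply Hlamk | intros; now apply Hprop]. }
  split.
  - intros T Tk. apply NL_iff_Lpb; try assumption.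
    + reflexivity.
    + intros k p Hk _. symmetry. now apply HK.
  - intros u uk HL Hru Hruk.
    (* The range hypotheses make the inverses genuine, so the recovered functions satisfy
       [u = K o T] and [uk = K o Tk] on the domains. *)
    refine (proj2 (NL_iff_Lpb N a r lam lamk C A th q1p q1m q2p q2m Hr Hin Hdisj Hlam Hpos
      HC Hprop _ u _ uk _ _) HL).
    + intros p Hp. symmetry. now apply inv_fun_right, Hru.
    + intros k p Hk Hp. rewrite (HK k _ Hk), (inv_fun_right _ _ (Hruk k p Hk Hp)).
      specialize (HC k Hk). field. lra.
Qed.
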